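(* Let $P$ be a kernel on $A$, let $\mathbf X$ be the stationary chain compatible with $P$, and let $k\ge 0$. Let $\{\mathcal I(\underline a)\}_{\underline a\in A^{-\mathbb N}}$ be a set of range partitions for $P$ such that $\Theta[0]\cap\Theta^{[k]}[0]$ is $\mathbb P$-a.s. non-empty. Then, for any random time $\theta[0]$ with $\theta[0]\in\Theta[0]$, $$\bar d(\mathbf X,\mathbf X^{[k]})\le \mathbb P\Big(\bigcup_{\underline a\in A^{-\mathbb N}}\ \bigcup_{i=\theta[0]}^{0}\big\{L\big(\underline a\,F_{\{\theta[0],i-1\}}(\underline a,U_{\theta[0]}^{i-1}),U_i\big)>k\big\}\Big),$$ where for $i=\theta[0]$ the event is $\{L(\underline a,U_{\theta[0]})>k\}$.
   Context: Alphabet and pasts. $A=\{1,\dots,N\}$ with $N\in\{1,2,\dots\}\cup\{\infty\}$ ($A=\{1,2,\dots\}$ if $N=\infty$). $A^{-\mathbb N}$ is the set of pasts $\underline a=\ldots a_{-2}a_{-1}$; $a_{-k}^{-1}=a_{-k}\ldots a_{-1}$ (empty string if $k=0$). Concatenation is written in temporal order: $\underline z a_{-k}^{-1}$ is the past whose last $k$ symbols are $a_{-k}^{-1}$, preceded by $\underline z$. Kernels, chains. A kernel is a (measurable) function $P:A\times A^{-\mathbb N}\to[0,1]$ with $\sum_{a\in A}P(a|\underline x)=1$ for all $\underline x$. A stationary chain $\mathbf X=(X_n)_{n\in\mathbb Z}$ with law $\mu$ on $A^{\mathbb Z}$ is compatible with $P$ if $\mu(X_0=a|X_{-\infty}^{-1}=\underline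 x)=P(a|\underline x)$ for all $a$ and $\mu$-a.e. $\underline x$. The canonical $k$-steps Markov approximation $\mathbf X^{[k]}$ is the stationary $k$-step Markov chain (i.i.d. if $k=0$) compatible with $P^{[k]}(a|x_{-k}^{-1})=\mu(X_0=a|X_{-k}^{-1}=x_{-k}^{-1})$, with $(X^{[k]}_1,\dots,X^{[k]}_k)$ distributed as $(X_1,\dots,X_k)$. On strings of $\mu$-probability zero, $P^{[k]}(\cdot|x_{-k}^{-1})$ is any fixed probability with $P^{[k]}(a|x_{-k}^{-1})\ge\inf_{\underline z}P(a|\underline z x_{-k}^{-1})$ for all $a$. For stationary chains, $\bar d(\mathbf X,\mathbf Y)=\inf\mathbb P(\bar X_0\ne\bar Y_0)$, infimum over all couplings $(\bar{\mathbf X},\bar{\mathbf Y})$ of $\mathbf X$ and $\mathbf Y$. Range partitions. A set of range partitions for $P$ is a family $\{\mathcal I(\underline a)\}_{\underline a}$, where $\mathcal I(\underline a)=\{I_k(a|a_{-k}^{-1})\}_{k\in\{0,1,2,\dots\}\cup\{\infty\},\,a\in A}$ is a partition of $[0,1[$ into (possibly empty) intervals, closed on the left and open on the right, such that: (1) the length $|I_k(a|a_{-k}^{-1})|$ depends only on $k$, $a$ and $a_{-k}^{-1}$ (on $a$ and $\underline a$ if $k=\infty$); (2) $\sum_{k\in\{0,1,\dots\}\cup\{\infty\}}|I_k(a|a_{-k}^{-1})|=P(a|\underline a)$ for all $a,\underline a$; (3) the intervals are placed consecutively from left to right in the order $I_0(1|\emptyset),I_0(2|\emptyset),\dots,I_1(1|a_{-1}),I_1(2|a_{-1}),\dots,I_2(1|a_{-2}^{-1}),\dots$,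 and finally $I_\infty(1|\underline a),I_\infty(2|\underline a),\dots$. Coupling from the past. $\mathbf U=(U_n)_{n\in\mathbb Z}$ are i.i.d. uniform on $[0,1[$, with probability $\mathbb P$. Define $F(\underline a,u)=a$ and $L(\underline a,u)=k$ if $u\in I_k(a|a_{-k}^{-1})$ (so $L$ takes values in $\{0,1,\dots\}\cup\{\infty\}$). For $m\le n$ define strings recursively by $F_{\{m,m\}}(\underline a,U_m)=F(\underline a,U_m)$ and $F_{\{m,n\}}(\underline a,U_m^n)=F_{\{m,n-1\}}(\underline a,U_m^{n-1})\,F(\underline aF_{\{m,n-1\}}(\underline a,U_m^{n-1}),U_n)$; by convention $F_{\{m,m-1\}}=\emptyset$. $F_{[m,n]}(\underline a,U_m^n)$ is the last symbol of $F_{\{m,n\}}(\underline a,U_m^n)$. The set of coalescence times is $\Theta[0]=\{j\le 0: F_{[j,0]}(\underline a,U_j^0)=F_{[j,0]}(\underline b,U_j^0)\ \forall\underline a,\underline b\in A^{-\mathbb N}\}$. Markov version. For $k\ge0$, one has $P^{[k]}(a|a_{-k}^{-1})\ge\sum_{j=0}^k|I_j(a|a_{-j}^{-1})|$; keep the intervals $I_j(a|a_{-j}^{-1})$, $0\le j\le k$, $a\in A$, and to their right place consecutively intervals $I^{[k]}(1|a_{-k}^{-1}),I^{[k]}(2|a_{-k}^{-1}),\dots$ of lengths $P^{[k]}(a|a_{-k}^{-1})-\sum_{j=0}^k|I_j(a|a_{-j}^{-1})|$. Define $F^{[k]}(a_{-k}^{-1},u)=a$ if $u\in\bigcup_{j=0}^kI_j(a|a_{-j}^{-1})\cup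 I^{[k]}(a|a_{-k}^{-1})$, viewed as a function of a past through its last $k$ symbols. $\Theta^{[k]}[0]$ is defined as $\Theta[0]$ with $F^{[k]}$ in place of $F$. *)

(* Defs.v *)
From HB Require Import structures.
From mathcomp Require Import all_boot all_order all_algebra.
From mathcomp Require Import finmap.
From mathcomp Require Import all_classical all_reals all_analysis.

Set Implicit Arguments.
Unset Strict Implicit.
Unset Printing Implicit Defensive.

Import Order.TTheory GRing.Theory Num.Theory.
Import numFieldNormedType.Exports.

Local Open Scope classical_set_scope.
Local Open Scope ring_scope.

(* {0, 1, 2, ...} with a largest element infinity, represented by [None]. *)
Definition enat := option nat.

Definition enat_lt (k l : enat) : bool :=
  match k, l with
  | Some i, Some j => (i < j)%N
  | Some _, None => true
  | None, _ => false
  end.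

Definition alphabet_size := {N : enat | enat_lt (Some 0%N) N}.

Definition is_symbol (N : alphabet_size) : pred nat :=
  fun a => (0 < a)%N && ~~ enat_lt (sval N) (Some a).

(* A = {1, ..., N}, resp. {1, 2, ...} *)
Definition alphabet (N : alphabet_size) := {a : nat | is_symbol N a}.

Lemma is_symbol1 (N : alphabet_size) : is_symbol N 1%N.
Proof. by case: N => [[[|n]|]]. Qed.

HB.instance Definition _ N := Countable.on (alphabet N).
HB.instance Definition _ N :=
  isPointed.Build (alphabet N) (exist _ 1%N (is_symbol1 N)).

(* The sigma-algebra of A^J is generated by the events {x_j = a}; since A is
   countable this is the product of the discrete sigma-algebras. *)
Definition coordinate_events (J : Type) (A : pointedType) : set (set (J -> A)) :=
  [set E | exists j a, E = [set x | x j = a]].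

Definition seqspace (J : Type) (A : pointedType) :=
  g_sigma_algebraType (@coordinate_events J A).

HB.instance Definition _ J A := Measurable.on (seqspace J A).

(* A past x stands for ... x_{-2} x_{-1}; the symbol x_{-i-1} is [x i]. *)
Definition past (A : pointedType) := seqspace nat A.
HB.instance Definition _ A := Measurable.on (past A).

Definition traj (A : pointedType) := seqspace int A.
HB.instance Definition _ A := Measurable.on (traj A).

Section Strings.
Variable A : pointedType.

Definition snoc (x : past A) (a : A) : past A :=
  fun i => if i is j.+1 then x j else a.

(* Strings are listed in temporal order, so the last entry of [s] is the most
   recent symbol of [append x s]. *)
Definition append (x : past A) (s : seq A) : past A := foldl snoc x s.

(* x_{-k}^{-1} *)
Definition recent (k : nat) (x : past A) : k.-tuple A :=
  [tuple x (rev_ord i) | i < k].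

(* X_{-infinity}^{-1} *)
Definition past_of (x : traj A) : past A := fun i => x (- i.+1%:Z).

Definition shift (x : traj A) : traj A := fun n => x (n + 1).

End Strings.

Section Chains.
Variables (R : realType) (A : pointedType).

Record is_kernel (P : A -> past A -> R) : Prop := {
  kernel_measurable : forall a, measurable_fun setT (P a);
  kernel_itv : forall a x, 0 <= P a x <= 1;
  kernel_sum : forall x, (\esum_(a in setT) (P a x)%:E = 1)%E }.

Definition stationary (mu : probability (traj A) R) : Prop :=
  forall B, measurable B -> mu (@shift A @^-1` B) = mu B.

(* [P a x] is a version of mu(X_0 = a | X_{-infinity}^{-1} = x): the defining
   property of conditional probabilities, on every event B of the past. *)
Definition compatible (mu : probability (traj A) R) (P : A -> past A -> R) :
    Prop :=
  forall (a : A) (B : set (past A)), measurable B ->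
    (mu ([set x : traj A | x 0%R = a] `&` (@past_of A @^-1` B)) =
     \int[mu]_(x in @past_of A @^-1` B) (P a (past_of x))%:E)%E.

Definition recent_event k (s : k.-tuple A) : set (traj A) :=
  [set x | recent k (past_of x) = s].

(* Pk is an admissible choice of P^{[k]}. *)
Record is_markov_kernel (P : A -> past A -> R) (mu : probability (traj A) R)
    (k : nat) (Pk : A -> k.-tuple A -> R) : Prop := {
  markov_kernel_ge0 : forall a s, 0 <= Pk a s;
  markov_kernel_sum : forall s, (\esum_(a in setT) (Pk a s)%:E = 1)%E;
  markov_kernel_cond : forall a s, mu (recent_event s) <> 0%E ->
    Pk a s = fine (mu ([set x : traj A | x 0%R = a] `&` recent_event s)) /
             fine (mu (recent_event s));
  markov_kernel_null : forall a s, mu (recent_event s) = 0%E ->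
    inf (range (fun z : past A => P a (append z s))) <= Pk a s }.

(* nu is the law of the stationary k-step chain X^{[k]} *)
Record is_markov_approximation (mu : probability (traj A) R) (k : nat)
    (Pk : A -> k.-tuple A -> R) (nu : probability (traj A) R) : Prop := {
  markov_approximation_stationary : stationary nu;
  markov_approximation_compatible :
    compatible nu (fun a x => Pk a (recent k x));
  markov_approximation_marginal : forall s : k.-tuple A,
    nu [set x : traj A | forall i : 'I_k, x i.+1%:Z = tnth s i] =
    mu [set x : traj A | forall i : 'I_k, x i.+1%:Z = tnth s i] }.

Definition is_coupling (mu nu : probability (traj A) R)
    (pi : probability (traj A * traj A)%type R) : Prop :=
  forall B, measurable B ->
    pi (fst @^-1` B) = mu B /\ pi (snd @^-1` B) = nu B.

Definition dbar (mu nu : probability (traj A) R) : \bar R :=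
  ereal_inf [set (pi : probability (traj A * traj A)%type R)
                   [set p : traj A * traj A | p.1 0 <> p.2 0]
            | pi in is_coupling mu nu].

End Chains.

Section RangePartitions.
Variables (R : realType) (N : alphabet_size).
Local Notation A := (alphabet N).

(* [I x k a] is the interval I_k(a | x_{-k}^{-1}), k = None being infinity. *)
Implicit Type I : past A -> enat -> A -> set R.

Definition len (J : set R) : \bar R := lebesgue_measure J.

(* The order I_0(1), I_0(2), ..., I_1(1), I_1(2), ..., I_infinity(1), ... *)
Definition before (p q : enat * A) : bool :=
  enat_lt p.1 q.1 || (p.1 == q.1) && (val p.2 < val q.2)%N.

(* As the intervals of [I x] cover [0,1[, being ordered as in
   [range_partition_order] means being placed consecutively. *)
Record is_range_partition (P : A -> past A -> R) I : Prop := {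
  range_partition_itv : forall x k a,
    exists l r : R, I x k a = [set` `[l, r[ ];
  range_partition_cover : forall x,
    \bigcup_(p in [set: enat * A]) I x p.1 p.2 = [set` `[0, 1[ ];
  range_partition_disjoint : forall x,
    trivIset [set: enat * A] (fun p => I x p.1 p.2);
  range_partition_local : forall (k : nat) a x y, recent k x = recent k y ->
    len (I x (Some k) a) = len (I y (Some k) a);
  range_partition_sum : forall a x,
    (\esum_(k in [set: enat]) len (I x k a) = (P a x)%:E)%E;
  range_partition_order : forall x p q, before p q ->
    forall u v, I x p.1 p.2 u -> I x q.1 q.2 v -> u < v }.

(* The pair (L(x,u), F(x,u)). Each u in [0,1[ lies in exactly one interval; the
   default value is only used for u outside [0,1[. *)
Definition LF I (x : past A) (u : R) : enat * A :=
  xget (None, x 0%N) [set p | I x p.1 p.2 u].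
Definition L I x u : enat := (LF I x u).1.
Definition F I x u : A := (LF I x u).2.

Section Markov.
Variables (k : nat) (Pk : A -> k.-tuple A -> R) (I : past A -> enat -> A -> set R).

Definition kept_len (x : past A) (a : A) : \bar R :=
  (\sum_(j < k.+1) len (I x (Some (j : nat)) a))%E.

Definition markov_len (x : past A) (a : A) : \bar R :=
  ((Pk a (recent k x))%:E - kept_len x a)%E.

(* right end of the union of the kept intervals *)
Definition kept_end (x : past A) : \bar R :=
  (\esum_(a in setT) kept_len x a)%E.

(* I^{[k]}(a | x_{-k}^{-1}) *)
Definition markov_itv (x : past A) (a : A) : set R :=
  [set u : R |
    (kept_end x + \esum_(b in [set b : A | (val b < val a)%N]) markov_len x b
       <= u%:E
     < kept_end x +
       \esum_(b in [set b : A | (val b <= val a)%N]) markov_len x b)%E].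

Definition Fk (x : past A) (u : R) : A :=
  xget (x 0%N) [set a | (exists2 j : nat, (j <= k)%N & I x (Some j) a u)
                        \/ markov_itv x a u].

End Markov.
End RangePartitions.

Section Coalescence.
Variables (R : realType) (A : pointedType) (G : past A -> R -> A).

Fixpoint run (x : past A) (u : int -> R) (m : int) (n : nat) : seq A :=
  if n is n'.+1 then
    let s := run x u m n' in rcons s (G (append x s) (u (m + n'%:Z)))
  else [::].

(* F_{\{m,n\}}(x, u_m^n) *)
Definition string (x : past A) (u : int -> R) (m n : int) : seq A :=
  if m <= n then run x u m `|n - m|%N.+1 else [::].

(* F_{[m,n]}(x, u_m^n), for m <= n *)
Definition last_symbol (x : past A) (u : int -> R) (m n : int) : A :=
  last (x 0%N) (string x u m n).

Definition Theta0 (u : int -> R) : set int :=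
  [set j | j <= 0 /\ forall a b : past A,
                       last_symbol a u j 0 = last_symbol b u j 0].

End Coalescence.

Section Uniform.
Variables (R : realType) (d : measure_display) (T : measurableType d).
Variable Pr : probability T R.

Definition mutually_independent (J : choiceType) (X : J -> {RV Pr >-> R}) :
    Prop :=
  forall (S : {fset J}) (B : J -> set R), (forall j, measurable (B j)) ->
    (Pr (\bigcap_(j in [set` S]) (X j @^-1` B j)) =
     \prod_(j <- S) Pr (X j @^-1` B j))%E.

Record iid_uniform (U : int -> {RV Pr >-> R}) : Prop := {
  iid_uniform_independent : mutually_independent U;
  iid_uniform_law : forall n B, measurable B ->
    distribution Pr (U n) B = uniform_prob (@ltr01 R) B;
  iid_uniform_itv : forall n w, 0 <= U n w < 1 }.

End Uniform.

(* Main.v *)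
(** Both chains are functions of the same innovations [U]. When [Theta0] is
    almost surely non-empty, the symbol produced at time 0 by the recursion
    started at time [-M] is eventually constant in [M], with a limit that does
    not depend on the initial past; as the law of [U] is shift invariant, the
    same holds at every time. The limiting trajectory has law [mu]: under [mu], a
    window of symbols is distributed as the end of a run of [F] whose initial
    past has law [mu], and by dominated convergence the influence of this past
    disappears when the start of the run goes to minus infinity. The same holds
    for [Fk] and the Markov approximation. If no symbol is read with [L > k] from
    time [theta] on, the runs of [F] and [Fk] started at [theta] coincide for
    every past, so that [theta] is a coalescence time of both and the two
    limits agree at time 0. *)

Require Import Defs.
From HB Require Import structures.
From mathcomp Require Import zify.
From mathcomp Require Import all_boot all_order all_algebra.
From mathcomp Require Import finmap.
From mathcomp Require Import all_classical all_reals all_analysis.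
From mathcomp Require Import measurable_realfun.

Set Implicit Arguments.
Unset Strict Implicit.
Unset Printing Implicit Defensive.

Import Order.TTheory GRing.Theory Num.Theory.
Import numFieldNormedType.Exports.

Local Open Scope classical_set_scope.
Local Open Scope ring_scope.

(** A run whose initial past has law [mu] is never built as a random object: an update rule is only
    handled as a measurable function of the innovation for one fixed past. For a fixed past [x] the
    law of the run is given by [string_prob P x], which is measurable in [x] because [P] is, and it
    is this number that is integrated against [mu].

    Two facts about the partitions have to be extracted beforehand. Locality is assumed for lengths
    only; that the intervals themselves agree for pasts with the same last symbols follows from
    their order, since an initial part of the family covers [0, c[ with c its total length. And [Fk]
    has the right law only if the kept lengths do not exceed [Pk]: on strings of positive
    probability because [Pk] averages [P] over pasts with the given ending, on the others by the
    bound through the infimum. *)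

Lemma countable_bigcup_measurable d (X : measurableType d) (T : countType)
    (D : set T) (F : T -> set X) :
  (forall i, D i -> measurable (F i)) -> measurable (\bigcup_(i in D) F i).
Proof.
move=> mF; rewrite bigcup_mkcond; apply: countable_bigcupT_measurable => [|i].
  exact: countableP.
by case: ifPn => // /set_mem; exact: mF.
Qed.

(** Reindexing by [pickle]: naturals that encode no element contribute zero. Countable additivity
    and the integration of series then apply to sums over symbols and strings. *)
Lemma esum_countable (R : realType) (T : countType) (f : T -> \bar R) :
  (forall t, 0 <= f t)%E ->
  (\esum_(t in [set: T]) f t =
   \sum_(n <oo) (if @pickle_inv T n is Some t then f t else 0))%E.
Proof.
move=> f0; set g := fun n => if @pickle_inv T n is Some t then f t else 0%E.
have g0 n : (0 <= g n)%E by rewrite /g; case: pickle_inv.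
rewrite (nneseries_esumT g0).
transitivity (\esum_(n in choice.pickle @` [set: T]) g n).
  rewrite esum_image; last by move=> a b _ _; exact: (pcan_inj (@choice.pickleK T)).
  by apply: eq_esum => t _; rewrite /g pickleK_inv.
rewrite esum_mkcond; apply: eq_esum => n _; case: ifPn => // nD.
rewrite /g; case E: (@pickle_inv T n) => [t|//].
move: nD; rewrite notin_setE; case; exists t => //.
by have := @pickle_invK T n; rewrite /ocancel E.
Qed.

Lemma measure_countable_bigcup d (X : measurableType d) (R : realType)
    (m : {measure set X -> \bar R}) (T : countType) (D : set T)
    (F : T -> set X) :
  (forall i, D i -> measurable (F i)) -> trivIset D F ->
  m (\bigcup_(i in D) F i) = \esum_(i in D) m (F i).
Proof.
move=> mF tF; rewrite esum_mkcond esum_countable; last by move=> t; case: ifP.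
pose G n := if @pickle_inv T n is Some i then if i \in D then F i else set0
            else set0.
have mG n : measurable (G n).
  rewrite /G; case: (@pickle_inv T n) => // i.
  by case: ifPn => // /set_mem; exact: mF.
have inG n x : G n x -> exists2 i, n = choice.pickle i & D i /\ F i x.
  rewrite /G; case E: (@pickle_inv T n) => [i|//]; case: ifPn => // iD Fx.
  exists i; last by split => //; exact: set_mem.
  by have := @pickle_invK T n; rewrite /ocancel E.
have -> : \bigcup_(i in D) F i = \bigcup_n G n.
  apply/seteqP; split => [x [i Di Fx]|x [n _ /inG[i _ [Di Fx]]]]; last by exists i.
  by exists (choice.pickle i) => //; rewrite /G pickleK_inv mem_set.
rewrite measure_semi_bigcup//; last exact: bigcupT_measurable.
  apply: eq_eseriesr => n _; rewrite /G; case: (@pickle_inv T n) => // i.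
  by case: ifP.
move=> i j _ _ [x [/inG[a -> [Da Fa]] /inG[b -> [Db Fb]]]].
by congr choice.pickle; apply: (tF a b) => //; exists x.
Qed.

(** * Range partitions *)

Section RangePartition.
Context (R : realType) (N : alphabet_size).
Local Notation A := (alphabet N).
Context (P : A -> past A -> R) (I : past A -> enat -> A -> set R).
Hypothesis hI : is_range_partition P I.

Lemma enat_lt_total (k l : enat) : [|| enat_lt k l, k == l | enat_lt l k].
Proof.
case: k l => [k|] [l|] //=.
by case: (ltngtP k l) => [||->]; rewrite ?eqxx ?orbT.
Qed.

Lemma before_total (p q : enat * A) : p <> q -> before p q || before q p.
Proof.
case: p q => [k a] [l b]; rewrite /before/= => neq.
case/or3P: (enat_lt_total k l) => [->//|/eqP kl|->]; last by rewrite orbT.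
case: (ltngtP (val a) (val b)) => [||ab]; rewrite ?kl ?eqxx ?andbT ?orbT//.
by case: neq; rewrite kl; congr pair; exact: val_inj.
Qed.

Lemma range_itv_measurable x k a : measurable (I x k a).
Proof. by have [l [r ->]] := range_partition_itv hI x k a. Qed.

Lemma range_itv_bounded x k a u : I x k a u -> 0 <= u < 1.
Proof.
move=> Iu; suff : [set` `[0, 1[] u by rewrite /= in_itv.
by rewrite -(range_partition_cover hI x); exists (k, a).
Qed.

Lemma range_itv_inj x u p q : I x p.1 p.2 u -> I x q.1 q.2 u -> p = q.
Proof.
move=> Ip Iq; have /(_ p q Logic.I Logic.I) := range_partition_disjoint hI (x := x).
by apply; exists u.
Qed.

Lemma LF_eq x u p : I x p.1 p.2 u -> LF I x u = p.
Proof.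
move=> Ip; rewrite /LF; case: xgetP => [q _ Iq|/(_ p)//].
exact: range_itv_inj Iq Ip.
Qed.

Lemma LF_mem x u : 0 <= u < 1 -> I x (LF I x u).1 (LF I x u).2 u.
Proof.
move=> u01; have : [set` `[0, 1[] u by rewrite /= in_itv.
by rewrite -(range_partition_cover hI x) => -[p _ Ip]; rewrite (LF_eq Ip).
Qed.

Lemma LF_out x u : ~~ (0 <= u < 1) -> LF I x u = (None, x 0%N).
Proof.
move=> u01; rewrite /LF; case: xgetP => // p _ Iq.
by move: u01; rewrite (range_itv_bounded Iq).
Qed.

Definition covered x (Q : set (enat * A)) : set R :=
  \bigcup_(p in Q) I x p.1 p.2.

Lemma covered_measurable x Q : measurable (covered x Q).
Proof.
by apply: countable_bigcup_measurable => p _; exact: range_itv_measurable.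
Qed.

Lemma len_covered x Q :
  len (covered x Q) = \esum_(p in Q) len (I x p.1 p.2).
Proof.
rewrite /len measure_countable_bigcup// => [p _|].
  exact: range_itv_measurable.
exact: sub_trivIset (range_partition_disjoint hI (x := x)).
Qed.

(** Downward closed for [before]. Such families cover an interval starting at 0, which is therefore
    known from its length alone. *)
Definition initial (Q : set (enat * A)) :=
  forall p q, Q q -> before p q -> Q p.

Lemma len_itv0 (u : R) : 0 <= u -> len [set` `[0, u[] = u%:E.
Proof.
move=> u0; rewrite /len lebesgue_measure_itv/= lte_fin.
case: ltP => [|u0']; first by rewrite oppr0 adde0.
by congr EFin; apply/eqP; rewrite eq_le u0 u0'.
Qed.

(** If u is covered, so is everything up to the right end of its interval, hence the length exceeds
    u. If u is not covered, nothing to its right is, because the order would put the interval of u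
    in [Q]; hence the length is at most u. *)
Lemma initial_covered x Q u : initial Q -> 0 <= u < 1 ->
  covered x Q u <-> (u%:E < len (covered x Q))%E.
Proof.
move=> Qi /andP[u0 u1]; split => [[p Qp Ip]|uK].
  have [l [r Ilr]] := range_partition_itv hI x p.1 p.2.
  have : [set` `[l, r[] u by rewrite -Ilr.
  rewrite /= in_itv/= => /andP[lu ur].
  (* Otherwise the interval would contain 1, which no interval does. The bound lets [LF_mem] place
     every point of [0, r[ in some interval. *)
  have r1 : r <= 1.
    rewrite leNgt; apply/negP => r1.
    have : I x p.1 p.2 1 by rewrite Ilr /= in_itv/= (le_trans lu (ltW u1)) r1.
    by move/range_itv_bounded; rewrite ltxx andbF.
  apply: (@lt_le_trans _ _ r%:E); first by rewrite lte_fin.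
  rewrite -(@len_itv0 r) ?(le_trans u0 (ltW ur))//.
  apply: le_measure; rewrite ?inE//; first exact: covered_measurable.
  move=> v /=; rewrite in_itv/= => /andP[v0 vr].
  have v01 : 0 <= v < 1 by rewrite v0 (lt_le_trans vr r1).
  have [lv|vl] := leP l v.
    by exists p => //; rewrite Ilr /= in_itv/= lv vr.
  have Iv := LF_mem x v01.
  exists (LF I x v) => //.
  have [->//|/eqP/before_total/orP[|pv]] := eqVneq (LF I x v) p.
    by apply: Qi.
  have := range_partition_order hI pv Ip Iv.
  by rewrite ltNge (le_trans (ltW vl) lu).
apply: contrapT => nK.
move: uK; rewrite ltNge => /negP; apply.
rewrite -(len_itv0 u0); apply: le_measure; rewrite ?inE//.
  exact: covered_measurable.
move=> v [p Qp Ip] /=; have /andP[v0 v1] := range_itv_bounded Ip.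
rewrite in_itv/= v0/= ltNge; apply/negP => uv.
have u01 : 0 <= u < 1 by rewrite u0 u1.
have Iu := LF_mem x u01.
have [E|/eqP/before_total/orP[up|pu]] := eqVneq (LF I x u) p.
- by apply: nK; exists p => //; rewrite -E.
- by apply: nK; exists (LF I x u) => //; exact: Qi up.
- by have := range_partition_order hI pu Ip Iu; rewrite ltNge uv.
Qed.

Lemma enat_lt_trans (a b c : enat) : enat_lt a b -> enat_lt b c -> enat_lt a c.
Proof. by case: a b c => [a|] [b|] [c|]//=; exact: ltn_trans. Qed.

Lemma before_trans (p q r : enat * A) : before p q -> before q r -> before p r.
Proof.
rewrite /before => /orP[pq|/andP[/eqP pq pq2]] /orP[qr|/andP[/eqP qr qr2]].
- by rewrite (enat_lt_trans pq qr).
- by rewrite -qr pq.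
- by rewrite pq qr.
- by rewrite pq qr eqxx (ltn_trans pq2 qr2) orbT.
Qed.

Lemma before_irr (p : enat * A) : before p p = false.
Proof. by case: p => -[k|] a; rewrite /before/= !ltnn ?andbF. Qed.

Lemma recent_le k j (x y : past A) : (j <= k)%N -> recent k x = recent k y ->
  recent j x = recent j y.
Proof.
move=> jk /(congr1 (fun s => tnth s)) E; apply: eq_from_tnth => i.
rewrite !tnth_mktuple.
have ik : (i < k)%N := leq_trans (ltn_ord i) jk.
have jik : (rev_ord (rev_ord (widen_ord jk (rev_ord i))) : nat) = rev_ord i.
  by rewrite rev_ordK.
have := congr1 (@^~ (rev_ord (widen_ord jk (rev_ord i)))) E.
by rewrite !tnth_mktuple rev_ordK.
Qed.

(* [I x (Some j) a] is the difference of two initial segments of [0,1[, whose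
   lengths are sums of lengths of intervals of depth at most [j]. *)
Lemma range_itv_local k x y j a : recent k x = recent k y -> (j <= k)%N ->
  I x (Some j) a `<=` I y (Some j) a.
Proof.
move=> xy jk u Iu.
pose Q1 := [set p : enat * A | before p (Some j, a)].
pose Q2 := [set p : enat * A | before p (Some j, a) \/ p = (Some j, a)].
have i1 : initial Q1 by move=> p q Qq pq; exact: before_trans pq Qq.
have i2 : initial Q2.
  move=> p q [Qq|->] pq; left => //; exact: before_trans pq Qq.
have lenE Q : Q `<=` Q2 -> len (covered x Q) = len (covered y Q).
  move=> QQ; rewrite !len_covered; apply: eq_esum => -[[i|] b] Qp.
    apply: (range_partition_local hI); apply: recent_le xy.
    apply: leq_trans jk.
    case: (QQ _ Qp) => [|[->//]].
    by rewrite /before/= => /orP[/ltnW//|/andP[/eqP[->]]].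
  by case: (QQ _ Qp) => [|//]; rewrite /before.
have u01 := range_itv_bounded Iu.
have : covered x Q2 u by exists (Some j, a) => //; right.
rewrite (initial_covered _ i2 u01) lenE// -(initial_covered _ i2 u01).
have nK1 : ~ covered y Q1 u.
  rewrite (initial_covered _ i1 u01) -lenE; last by move=> p; left.
  rewrite -(initial_covered _ i1 u01) => -[p Qp Ip].
  have E := @range_itv_inj x u p (Some j, a) Ip Iu.
  by move: Qp; rewrite /Q1/= E before_irr.
by case=> p [Q1p Ip|-> //]; case: nK1; exists p.
Qed.

Lemma range_itv_localE k x y j a : recent k x = recent k y -> (j <= k)%N ->
  I x (Some j) a = I y (Some j) a.
Proof.
by move=> xy jk; apply/seteqP; split; apply: range_itv_local jk.
Qed.

Lemma LF_local k x y u : 0 <= u < 1 -> recent k x = recent k y ->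
  ~~ enat_lt (Some k) (L I x u) -> LF I x u = LF I y u.
Proof.
move=> u01 xy; have := LF_mem x u01; rewrite /L.
case: (LF I x u) => -[j|] a//= Ix; rewrite -leqNgt => jk.
by apply/esym/LF_eq => /=; rewrite -(range_itv_localE _ xy jk).
Qed.

(** As soon as one of the two depths is at most k, [LF_local] applied from that side makes the
    depths equal. *)
Lemma L_local k x y u : 0 <= u < 1 -> recent k x = recent k y ->
  enat_lt (Some k) (L I x u) = enat_lt (Some k) (L I y u).
Proof.
move=> u01 xy; apply/idP/idP; apply: contraTT => h.
  by rewrite /L -(LF_local u01 (esym xy) h).
by rewrite /L -(LF_local u01 xy h).
Qed.

(** The restriction to [0,1[ removes the points where [LF] takes its default depth [None], which
    lies above every finite k. *)
Lemma L_measurable k x : measurable [set u | 0 <= u < 1 /\ enat_lt k (L I x u)].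
Proof.
have -> : [set u | 0 <= u < 1 /\ enat_lt k (L I x u)] =
    covered x [set p | enat_lt k p.1].
  apply/seteqP; split => [u [u01 h]|u [p kp Ip]].
    by exists (LF I x u) => //; exact: LF_mem.
  by split; [exact: range_itv_bounded Ip|rewrite /L (LF_eq Ip)].
exact: covered_measurable.
Qed.

End RangePartition.

Lemma uniform_prob_len (R : realType) (B : set R) : measurable B ->
  B `<=` [set u | 0 <= u < 1] -> uniform_prob (@ltr01 R) B = len B.
Proof.
move=> mB B01; rewrite /uniform_prob integral_uniform_pdf.
have -> : B `&` `[0, 1]%classic = B.
  apply/setIidPl => u /B01/= /andP[u0 u1].
  by rewrite in_itv/= u0 ltW.
rewrite (eq_integral (cst 1%E)) ?integral_cst ?mul1e// => u /set_mem/B01/=.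
by rewrite /uniform_pdf => /andP[u0 u1]; rewrite u0 ltW//= subr0 invr1.
Qed.

Lemma appendE (A : pointedType) (a0 : A) (x : past A) (s : seq A) i :
  append x s i = if (i < size s)%N then nth a0 s (size s - i.+1)
                 else x (i - size s)%N.
Proof.
elim/last_ind: s i => [|s a IH] i; first by rewrite subn0.
rewrite /append foldl_rcons -/(append x s) size_rcons.
case: i => [|i]/=; first by rewrite subn1/= nth_rcons ltnn eqxx.
rewrite IH ltnS !subSS nth_rcons; case: ltnP => // ins.
by rewrite ifT//; lia.
Qed.

Lemma recent_append (A : pointedType) k (x : past A) (s : k.-tuple A) :
  recent k (append x s) = s.
Proof.
apply: eq_from_tnth => i; rewrite tnth_mktuple.
rewrite (appendE (tnth_default s i)) size_tuple ltn_ord/=.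
rewrite (tnth_nth (tnth_default s i)); congr nth.
by have := ltn_ord i; lia.
Qed.

(** * The laws of the symbols read by [F] and [Fk] *)

Section SymbolLaw.
Context (R : realType) (N : alphabet_size).
Local Notation A := (alphabet N).
Context (P : A -> past A -> R) (I : past A -> enat -> A -> set R).
Hypothesis hI : is_range_partition P I.

Lemma F_fiber x a : [set u | 0 <= u < 1 /\ F I x u = a] =
  \bigcup_(k in [set: option nat]) I x k a.
Proof.
apply/seteqP; split => [u [u01 <-]|u [k _ Iu]].
  by exists (LF I x u).1 => //; exact: (LF_mem hI).
split; first exact: range_itv_bounded hI _ _ _ _ Iu.
by rewrite /F (LF_eq hI (p := (k, a)) Iu).
Qed.

Lemma F_fiber_measurable x a : measurable [set u | 0 <= u < 1 /\ F I x u = a].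
Proof.
rewrite F_fiber; apply: countable_bigcup_measurable => k _.
exact: range_itv_measurable hI _ _ _.
Qed.

Lemma F_law x a : len [set u | 0 <= u < 1 /\ F I x u = a] = (P a x)%:E.
Proof.
rewrite F_fiber /len measure_countable_bigcup.
- exact: range_partition_sum hI _ _.
- by move=> k _; exact: range_itv_measurable hI _ _ _.
- move=> k l _ _ [u [Ik Il]].
  by have [] := range_itv_inj hI (p := (k, a)) (q := (l, a)) Ik Il.
Qed.

Section Markov.
Context (k : nat) (Pk : A -> k.-tuple A -> R).
Hypothesis Pk_sum : forall s, (\esum_(a in setT) (Pk a s)%:E = 1)%E.
Hypothesis kept_le : forall a x, (kept_len k I x a <= (Pk a (recent k x))%:E)%E.

Local Notation K x := (covered I x [set p | ~~ enat_lt (Some k) p.1]).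

(** In general not an interval: one piece per depth, separated by the pieces of the other
    symbols. *)
Definition kept_itv x a : set R := \big[setU/set0]_(j < k.+1) I x (Some (j : nat)) a.

Lemma kept_itvP x a u :
  kept_itv x a u <-> exists2 j : nat, (j <= k)%N & I x (Some j) a u.
Proof.
rewrite /kept_itv -(bigcup_mkord k.+1 (fun j => I x (Some j) a)); split => -[j jk Ij]; exists j => //.
Qed.

Lemma kept_itv_measurable x a : measurable (kept_itv x a).
Proof.
by apply: bigsetU_measurable => j _; exact: range_itv_measurable hI _ _ _.
Qed.

Lemma len_kept_itv x a : len (kept_itv x a) = kept_len k I x a.
Proof.
rewrite /len /kept_itv measure_bigsetU_ord//.
  by move=> j; exact: range_itv_measurable hI _ _ _.
move=> i j _ _ [u [Ik Il]]; apply: val_inj => /=.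
by have [] := range_itv_inj hI (p := (Some (i : nat), a))
  (q := (Some (j : nat), a)) Ik Il.
Qed.

Lemma initial_kept : initial [set p : enat * A | ~~ enat_lt (Some k) p.1].
Proof.
move=> p q; rewrite /mkset => Qq pq; apply: contra Qq => kp.
case/orP: pq => [pq|/andP[/eqP pq _]]; first exact: enat_lt_trans kp pq.
by rewrite -pq.
Qed.

Lemma covered_kept x : K x = \bigcup_(a in [set: A]) kept_itv x a.
Proof.
apply/seteqP; split => [u [[[j|] a]//= jk Iu]|u [a _ /kept_itvP[j jk Iu]]].
  by exists a => //; apply/kept_itvP; exists j => //; rewrite leqNgt.
by exists (Some j, a) => //=; rewrite -leqNgt.
Qed.

(** Together with [initial_kept] and [initial_covered], this makes [K x] the interval from 0 to
    [kept_end], so the Markov intervals start exactly where the kept ones stop. *)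
Lemma len_kept x : len (K x) = kept_end k I x.
Proof.
rewrite covered_kept /len measure_countable_bigcup; last 2 first.
- by move=> a _; exact: kept_itv_measurable.
- move=> a b _ _ [u [/kept_itvP[i _ Ia] /kept_itvP[j _ Ib]]].
  by have [] := range_itv_inj hI (p := (Some i, a)) (q := (Some j, b)) Ia Ib.
by apply: eq_esum => a _; exact: len_kept_itv.
Qed.

Lemma kept_len_ge0 x a : (0 <= kept_len k I x a)%E.
Proof. by rewrite -len_kept_itv /len. Qed.

Lemma kept_len_fin x a : kept_len k I x a \is a fin_num.
Proof.
rewrite ge0_fin_numE ?kept_len_ge0//.
by rewrite (le_lt_trans (kept_le a x)) ?ltry.
Qed.

Lemma markov_len_ge0 x a : (0 <= markov_len Pk I x a)%E.
Proof. by rewrite /markov_len sube_ge0 ?kept_len_fin. Qed.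

Lemma kept_markov_len x a :
  (kept_len k I x a + markov_len Pk I x a = (Pk a (recent k x))%:E)%E.
Proof. by rewrite /markov_len addeC subeK// kept_len_fin. Qed.

(** For each symbol the two lengths add up to [Pk], whose sum is 1; so the Markov intervals have
    exactly the room left in [0,1[. *)
Lemma kept_markov_sum x :
  (kept_end k I x + \esum_(a in setT) markov_len Pk I x a = 1)%E.
Proof.
rewrite -esumD; last 2 first.
- by move=> *; exact: kept_len_ge0.
- by move=> *; exact: markov_len_ge0.
by rewrite -(Pk_sum (recent k x)); apply: eq_esum => a _; exact: kept_markov_len.
Qed.

(** Left end of the Markov interval of the symbol n. It is defined for every natural number, so that
    the interval containing a point can be found by taking a least index. *)
Definition cutoff x n : \bar R :=
  (kept_end k I x + \esum_(b in [set b : A | (val b < n)%N]) markov_len Pk I x b)%E.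

Lemma markov_itvE x a : markov_itv Pk I x a =
  [set u : R | (cutoff x (val a) <= u%:E < cutoff x (val a).+1)%E].
Proof. by []. Qed.

Lemma cutoff_le x m n : (m <= n)%N -> (cutoff x m <= cutoff x n)%E.
Proof.
move=> mn; rewrite leeD2l// esum_mkcond [leRHS]esum_mkcond.
apply: le_esum => b _; case: ifPn => [/set_mem/= bm|_].
  by rewrite ifT// inE/=; exact: leq_trans bm mn.
by case: ifPn => // _; exact: markov_len_ge0.
Qed.

Lemma cutoff_ge0 x n : (0 <= cutoff x n)%E.
Proof.
by rewrite adde_ge0// esum_ge0// => a _; rewrite ?kept_len_ge0 ?markov_len_ge0.
Qed.

Lemma cutoff_le1 x n : (cutoff x n <= 1)%E.
Proof.
rewrite -(kept_markov_sum x) leeD2l// esum_mkcond.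
by apply: le_esum => b _; case: ifPn => // _; exact: markov_len_ge0.
Qed.

Lemma cutoff_fin x n : cutoff x n \is a fin_num.
Proof.
rewrite ge0_fin_numE ?cutoff_ge0//.
by rewrite (le_lt_trans (cutoff_le1 x n)) ?ltry.
Qed.

Lemma cutoff0 x : cutoff x 0 = kept_end k I x.
Proof.
rewrite /cutoff [X in esum X _](_ : _ = set0) ?esum_set0 ?adde0//.
by apply/seteqP; split => b.
Qed.

Lemma cutoffS x a :
  cutoff x (val a).+1 = (cutoff x (val a) + markov_len Pk I x a)%E.
Proof.
rewrite /cutoff -addeA; congr (_ + _)%E.
rewrite (esumID [set a]) => [|b _]; last exact: markov_len_ge0.
rewrite addeC; congr (_ + _)%E.
  congr esum; apply/seteqP; split => [b [/= ba nab]|b /= ba].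
    rewrite ltn_neqAle -ltnS ba andbT; apply: contra_not_neq nab; exact: val_inj.
  by split; [exact: ltnW|move=> ab; move: ba; rewrite ab ltnn].
rewrite [X in esum X _](_ : _ = [set a]) ?esum_set1 ?markov_len_ge0//.
by apply/setIidPr => b -> /=.
Qed.

(** When n is 0 or exceeds the alphabet size, passing from n to its successor adds no symbol to the
    sum. *)
Lemma cutoff_gap x n : (cutoff x n < cutoff x n.+1)%E ->
  exists a : A, val a = n.
Proof.
case: (boolP (is_symbol N n)) => [sn _|nsn]; first by exists (exist _ n sn).
rewrite /cutoff (_ : [set b : A | (val b < n.+1)%N] = [set b | (val b < n)%N]).
  by rewrite ltxx.
apply/seteqP; split => b /= bn; last exact: ltnW.
rewrite ltn_neqAle -ltnS bn andbT; apply: contra nsn => /eqP <-.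
exact: valP.
Qed.

Lemma cutoff_sup x (u : R) : u < 1 -> exists n, (u%:E < cutoff x n)%E.
Proof.
move=> u1; pose v := (u%:E - kept_end k I x)%E.
have kfin : kept_end k I x \is a fin_num by rewrite -cutoff0 cutoff_fin.
have : (v < \esum_(a in setT) markov_len Pk I x a)%E.
  rewrite /v lteBlDl//.
  by rewrite kept_markov_sum lte_fin.
move=> /ereal_sup_gt[_ [X [finX _] <-]] vX.
(* The full sum is a supremum of finite ones; [X] is a finite set of symbols that already exceeds
   [v], and the cutoff is taken just beyond its largest element. *)
exists (\max_(b <- fset_set X) (val b)).+1.
rewrite /cutoff -lteBlDl//; apply: lt_le_trans vX _.
rewrite -esum_fset => [|//|b _]; last exact: markov_len_ge0.
rewrite esum_mkcond [leRHS]esum_mkcond.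
apply: le_esum => b _; case: ifPn => [bX|_].
  rewrite ifT// inE/= ltnS.
  by apply: (@leq_bigmax_seq _ _ _ (fun b : A => val b)); rewrite ?in_fset_set.
by case: ifPn => // _; exact: markov_len_ge0.
Qed.

Lemma markov_itv_cover x u : 0 <= u < 1 -> ~ K x u ->
  exists a, markov_itv Pk I x a u.
Proof.
move=> u01 nK; have /andP[u0 u1] := u01.
have ku : (cutoff x 0 <= u%:E)%E.
  rewrite cutoff0 -len_kept leNgt; apply/negP => h; apply: nK.
  exact/(initial_covered hI _ initial_kept u01).
have ex : exists n, (u%:E < cutoff x n)%E by exact: cutoff_sup.
(* The least index whose cutoff exceeds u is not 0, since cutoff 0 is the end of the kept part; its
   predecessor is the symbol sought. *)
case: (ex_minnP ex) => -[|n] un nmin; first by move: un; rewrite ltNge ku.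
have nu : (cutoff x n <= u%:E)%E.
  by rewrite leNgt; apply/negP => /nmin; rewrite ltnn.
have [a an] := cutoff_gap (le_lt_trans nu un).
by exists a; rewrite markov_itvE/= an nu un.
Qed.

Lemma markov_itv_inj x u a b :
  markov_itv Pk I x a u -> markov_itv Pk I x b u -> a = b.
Proof.
have main c d : markov_itv Pk I x c u -> markov_itv Pk I x d u ->
    (val c < val d)%N -> False.
  move=> /andP[_ uc] /andP[du _] cd.
  have := lt_le_trans uc (le_trans (cutoff_le x cd) du).
  by rewrite ltxx.
move=> Ma Mb; apply: val_inj => /=.
by case: (ltngtP (val a) (val b)) => // h; case: (main _ _ _ _ h).
Qed.

Lemma markov_itv_kept x u a : 0 <= u < 1 -> markov_itv Pk I x a u -> ~ K x u.
Proof.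
move=> u01 /andP[au _] /(initial_covered hI _ initial_kept u01).
rewrite len_kept -cutoff0 => h.
by have := lt_le_trans h (le_trans (cutoff_le x (leq0n (val a))) au); rewrite ltxx.
Qed.

Lemma markov_itv_bounded x u a : markov_itv Pk I x a u -> 0 <= u < 1.
Proof.
rewrite markov_itvE/= => /andP[au ua].
rewrite -!lee_fin -!lte_fin (le_trans (cutoff_ge0 _ _) au).
exact: lt_le_trans ua (cutoff_le1 _ _).
Qed.

Lemma len_markov_itv x a : len (markov_itv Pk I x a) = markov_len Pk I x a.
Proof.
have -> : markov_itv Pk I x a =
    [set` `[fine (cutoff x (val a)), fine (cutoff x (val a).+1)[].
  apply/seteqP; split => u; rewrite markov_itvE /= in_itv/= -lee_fin -lte_fin;
  by rewrite !fineK ?cutoff_fin.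
rewrite /len lebesgue_measure_itv/= lte_fin -lte_fin !fineK ?cutoff_fin//.
rewrite cutoffS; have := cutoff_fin x (val a).
case: (cutoff x (val a)) (markov_len_ge0 x a) => //= c.
case: (markov_len Pk I x a) => //= [m|].
  rewrite lee_fin -!EFinD lte_fin => m0 _.
  case: ifPn; first by rewrite addrAC subrr add0r.
  by rewrite -leNgt gerDl => m0'; congr EFin; apply/eqP; rewrite eq_le m0 m0'.
by move=> _ _; rewrite addey// ltry addye.
Qed.

Lemma markov_itv_measurable x a : measurable (markov_itv Pk I x a).
Proof.
have -> : markov_itv Pk I x a =
    [set` `[fine (cutoff x (val a)), fine (cutoff x (val a).+1)[].
  apply/seteqP; split => u; rewrite markov_itvE /= in_itv/= -lee_fin -lte_fin;
  by rewrite !fineK ?cutoff_fin.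
exact: measurable_itv.
Qed.

(** [Fk] picks some admissible symbol, so uniqueness is needed: kept and Markov parts lie on either
    side of [kept_end], and within each of them distinct symbols have disjoint parts. *)
Lemma Fk_eq x u a : 0 <= u < 1 ->
  kept_itv x a u \/ markov_itv Pk I x a u -> Fk Pk I x u = a.
Proof.
move=> u01 h.
have kK b : kept_itv x b u -> K x u by rewrite covered_kept => h'; exists b.
rewrite /Fk; case: xgetP => [b _ [/kept_itvP hb|hb]|/(_ a)]; last first.
  by case: h => [/kept_itvP h|h]; case; [left|right].
- case: h => [ha|ha]; first by case: (markov_itv_kept u01 hb (kK _ ha)).
  exact: markov_itv_inj hb ha.
case: h => [ha|ha]; last by case: (markov_itv_kept u01 ha (kK _ hb)).
move: ha hb => /kept_itvP[i _ Ia] /kept_itvP[j _ Ib].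
by have [] := range_itv_inj hI (p := (Some j, b)) (q := (Some i, a)) Ib Ia.
Qed.

Lemma Fk_fiber x a : [set u | 0 <= u < 1 /\ Fk Pk I x u = a] =
  kept_itv x a `|` markov_itv Pk I x a.
Proof.
apply/seteqP; split => [u [u01 <-]|u h].
  have [|/(markov_itv_cover u01)[b hb]] := EM (K x u).
    rewrite covered_kept => -[b _ hb].
    by left; rewrite (Fk_eq u01 (or_introl hb)).
  by right; rewrite (Fk_eq u01 (or_intror hb)).
have u01 : 0 <= u < 1.
  case: h => [/kept_itvP[j _ Ij]|/markov_itv_bounded//].
  exact: range_itv_bounded hI _ _ _ _ Ij.
by split => //; exact: Fk_eq.
Qed.

Lemma Fk_fiber_measurable x a :
  measurable [set u | 0 <= u < 1 /\ Fk Pk I x u = a].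
Proof.
rewrite Fk_fiber; apply: measurableU; first exact: kept_itv_measurable.
exact: markov_itv_measurable.
Qed.

Lemma Fk_law x a :
  len [set u | 0 <= u < 1 /\ Fk Pk I x u = a] = (Pk a (recent k x))%:E.
Proof.
rewrite Fk_fiber /len measureU.
- by rewrite -kept_markov_len -len_kept_itv -len_markov_itv.
- exact: kept_itv_measurable.
- exact: markov_itv_measurable.
rewrite -subset0 => u [ku mu].
apply: (markov_itv_kept (markov_itv_bounded mu) mu).
by rewrite covered_kept; exists a.
Qed.

(** The intervals of depth at most k are common to both rules. *)
Lemma Fk_F x u : 0 <= u < 1 -> ~~ enat_lt (Some k) (L I x u) ->
  Fk Pk I x u = F I x u.
Proof.
move=> u01 Lk; apply: Fk_eq => //; left; apply/kept_itvP.
have := LF_mem hI x u01; move: Lk; rewrite /L /F.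
by case: (LF I x u) => -[j|] b //=; rewrite -leqNgt => jk Ij; exists j.
Qed.

End Markov.
End SymbolLaw.

(** * Finite-dimensional laws *)

Lemma countable_bigcap_measurable d (X : measurableType d) (T : countType)
    (D : set T) (F : T -> set X) :
  (forall i, D i -> measurable (F i)) -> measurable (\bigcap_(i in D) F i).
Proof.
move=> mF; rewrite -[X in measurable X]setCK setC_bigcap; apply: measurableC.
by apply: countable_bigcup_measurable => i Di; exact/measurableC/mF.
Qed.

Lemma measurable_all d (X : measurableType d) (T : countType) (Q : T -> X -> Prop) :
  (forall i, measurable [set x | Q i x]) -> measurable [set x | forall i, Q i x].
Proof.
move=> mQ; rewrite (_ : [set x | _] = \bigcap_i [set x | Q i x]).
  by apply: countable_bigcap_measurable => i _; exact: mQ.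
by apply/seteqP; split => [x xQ i _|x xQ i]; [exact: xQ|exact: (xQ i)].
Qed.

Lemma measurable_ex d (X : measurableType d) (T : countType) (Q : T -> X -> Prop) :
  (forall i, measurable [set x | Q i x]) -> measurable [set x | exists i, Q i x].
Proof.
move=> mQ; rewrite (_ : [set x | _] = \bigcup_i [set x | Q i x]).
  by apply: countable_bigcup_measurable => i _; exact: mQ.
by apply/seteqP; split => x [i]; [exists i|exists i].
Qed.

Lemma measurable_imp d (X : measurableType d) (b : bool) (Q : X -> Prop) :
  measurable [set x | Q x] -> measurable [set x | b -> Q x].
Proof.
move=> mQ; case: b.
  by rewrite (_ : [set x | _] = [set x | Q x])//; apply/seteqP; split => x //= /(_ isT).
by rewrite (_ : [set x | _] = setT)//; apply/seteqP; split.
Qed.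

Lemma measurable_fun_countable d d' (X : measurableType d) (Y : measurableType d')
    (T : countType) (f : X -> T) (g : T -> Y) :
  (forall t, measurable [set x | f x = t]) -> measurable_fun setT (g \o f).
Proof.
move=> mf _ B mB; rewrite setTI.
rewrite (_ : _ @^-1` _ = \bigcup_(t in [set t | B (g t)]) [set x | f x = t]).
  by apply: countable_bigcup_measurable => t _; exact: mf.
by apply/seteqP; split => [x Bx|x [t /= Bt ft]]; [exists (f x)|rewrite /= ft].
Qed.

Section SeqSpace.
Context (N : alphabet_size).
Local Notation A := (alphabet N).

Lemma coordinate_measurable J (j : J) (a : A) :
  measurable [set x : seqspace J A | x j = a].
Proof. by apply: sub_sigma_algebra; exists j, a. Qed.

Lemma measurable_fun_seqspace d (X : measurableType d) J (f : X -> seqspace J A) :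
  (forall j a, measurable [set w | f w j = a]) -> measurable_fun setT f.
Proof.
move=> mf; apply: (@measurability _ _ X (seqspace J A) setT f (@coordinate_events J A)) => //.
by move=> _ [_ [j [a ->]] <-]; rewrite setTI; exact: mf.
Qed.

Lemma past_of_measurable : measurable_fun setT (@past_of A).
Proof. by apply: measurable_fun_seqspace => j a; exact: coordinate_measurable. Qed.

Lemma shift_measurable : measurable_fun setT (@Defs.shift A).
Proof. by apply: measurable_fun_seqspace => j a; exact: coordinate_measurable. Qed.

Lemma snoc_measurable (a : A) : measurable_fun setT (fun x : past A => snoc x a).
Proof.
apply: measurable_fun_seqspace => -[|j] b /=; last exact: coordinate_measurable.
have [<-|ab] := EM (a = b).
  by rewrite (_ : [set _ | _] = setT)//; apply/seteqP; split.
by rewrite (_ : [set _ | _] = set0)//; apply/seteqP; split.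
Qed.

Lemma preimage_past_measurable (B : set (past A)) :
  measurable B -> measurable (@past_of A @^-1` B).
Proof. by move=> mB; rewrite -[X in measurable X]setTI; exact: past_of_measurable. Qed.

Lemma recent_measurable k (s : k.-tuple A) :
  measurable [set x : past A | recent k x = s].
Proof.
rewrite (_ : [set _ | _] =
    [set x | forall i : 'I_k, x (rev_ord i : nat) = tnth s i]).
  by apply: measurable_all => i; exact: coordinate_measurable.
apply/seteqP; split => x /=; first by move=> <- i; rewrite tnth_mktuple.
by move=> xs; apply: eq_from_tnth => i; rewrite tnth_mktuple xs.
Qed.

End SeqSpace.

(** * Chains compatible with a kernel *)

Section Chain.
Context (R : realType) (N : alphabet_size).
Local Notation A := (alphabet N).
Context (P : A -> past A -> R) (hP : is_kernel P).
Context (mu : probability (traj A) R).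
Hypotheses (mu_stat : stationary mu) (mu_P : compatible mu P).

(** [kept_len] depends only on the last k symbols and is at most [P a y] for every past [y] ending
    with them. Hence it is below the infimum of [P a] over these pasts, and below its [mu]-average
    over them, which is [Pk] when the string has positive probability. *)
Lemma kept_len_le_markov k (Pk : A -> k.-tuple A -> R)
    (I : past A -> enat -> A -> set R) :
  is_markov_kernel P mu Pk -> is_range_partition P I ->
  forall a x, (kept_len k I x a <= (Pk a (recent k x))%:E)%E.
Proof.
move=> hPk hI a x.
have kept_ge0 y b : (0 <= kept_len k I y b)%E by apply: sume_ge0 => j _; rewrite /len.
have kept_P y b : (kept_len k I y b <= (P b y)%:E)%E.
  rewrite -(range_partition_sum hI) /kept_len.
  rewrite -(big_mkord xpredT (fun j => len (I y (Some j) b))).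
  rewrite -(big_map Some xpredT (fun j => len (I y j b))).
  have uq : uniq [seq Some i | i <- index_iota 0 k.+1].
    by rewrite map_inj_uniq ?iota_uniq// => i j [].
  apply: esum_ge; exists [set` [seq Some i | i <- index_iota 0 k.+1]].
    by split => //; exact: finite_seq.
  by rewrite -fsbig_seq.
have kept_local y : recent k y = recent k x -> kept_len k I y a = kept_len k I x a.
  move=> yx; apply: eq_bigr => j _.
  by rewrite (range_itv_localE hI a yx)// -ltnS.
have kfin y b : kept_len k I y b \is a fin_num.
  by rewrite ge0_fin_numE//; apply: (le_lt_trans (kept_P _ _)); rewrite ltry.
set s := recent k x.
have mB : measurable [set y : past A | recent k y = s] by exact: recent_measurable.
have mE : measurable (recent_event s) by exact: preimage_past_measurable mB.
have [s0|s0] := EM (mu (recent_event s) = 0%E).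
  apply: (@le_trans _ _ (inf (range (fun z : past A => P a (append z s))))%:E).
    rewrite -(fineK (kfin x a)) lee_fin; apply: lb_le_inf.
      by exists (P a (append point s)), point.
    move=> _ [z _ <-]; rewrite -lee_fin fineK// -(kept_local (append z s)) //.
    by rewrite recent_append.
  by rewrite lee_fin; exact: (markov_kernel_null hPk).
rewrite (markov_kernel_cond hPk a s0).
have muE_fin : mu (recent_event s) \is a fin_num by exact: fin_num_measure.
have muE_gt0 : 0 < fine (mu (recent_event s)).
  rewrite fine_gt0// -ge0_fin_numE// muE_fin andbT lt_def measure_ge0 andbT.
  by apply: contra_notN s0 => /eqP.
rewrite -(fineK (kfin x a)) lee_fin ler_pdivlMr// -lee_fin EFinM !fineK//; last first.
  apply: fin_num_measure; apply: measurableI => //; exact: coordinate_measurable.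
(* After multiplication by the probability of the string, the left side is the integral of a
   constant over the event and the right side that of [P a]. *)
rewrite (mu_P a mB) -integral_cst//; apply: ge0_le_integral => //.
- by move=> *; exact: kept_ge0.
- apply/measurable_EFinP; apply: measurable_funTS.
  by apply: measurableT_comp (kernel_measurable hP a) _; exact: past_of_measurable.
- by move=> y /= ys; rewrite -(kept_local (past_of y))//; exact: kept_P.
Qed.

Import HBNNSimple.

(** Passes from events of the past to nonnegative functions of the past: simple approximations, with
    monotone convergence on both sides. *)
Lemma compatible_integral a (f : past A -> \bar R) :
  measurable_fun setT f -> (forall x, 0 <= f x)%E ->
  (\int[mu]_(x in [set x : traj A | x 0%R = a]) f (past_of x) =
   \int[mu]_x ((P a (past_of x))%:E * f (past_of x)))%E.
Proof.
move=> mf f0; set D := [set x : traj A | x 0%R = a].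
have mD : measurable D by exact: coordinate_measurable.
have P0 x : (0 <= (P a x)%:E)%E by rewrite lee_fin; case/andP: (kernel_itv hP a x).
have mPp : measurable_fun setT (fun x : traj A => (P a (past_of x))%:E).
  apply/measurable_EFinP.
  by apply: measurableT_comp (kernel_measurable hP a) _; exact: past_of_measurable.
pose f_ := nnsfun_approx measurableT mf.
have mf_ n : measurable_fun setT (fun x : traj A => (f_ n (past_of x))%:E).
  by apply/measurable_EFinP; apply: measurableT_comp => //; exact: past_of_measurable.
have ndf x : {homo (fun n => (f_ n x)%:E) : n m / (n <= m)%N >-> (n <= m)%E}.
  by move=> m n mn; rewrite lee_fin; exact/lefP/nd_nnsfun_approx.
have cvf x : (f_ n x)%:E @[n --> \oo] --> f x by exact: cvg_nnsfun_approx.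
transitivity (lim (\int[mu]_(x in D) (f_ n (past_of x))%:E @[n --> \oo])%E).
  rewrite -monotone_convergence//.
  - by apply: eq_integral => x _; apply/esym/cvg_lim.
  - by move=> n; exact: measurable_funTS.
  - by move=> n x _; rewrite lee_fin.
transitivity (lim (\int[mu]_x ((P a (past_of x))%:E * (f_ n (past_of x))%:E)
    @[n --> \oo])%E); last first.
  rewrite -monotone_convergence//.
  - apply: eq_integral => x _; apply/cvg_lim => //.
    by apply: cvgeZl.
  - by move=> n; apply: emeasurable_funM.
  - by move=> n x _; rewrite mule_ge0// lee_fin.
  - by move=> x _ m n mn; rewrite lee_wpmul2l//; exact: ndf.
(* Only simple functions remain. Their level sets are events of the past, to which [mu_P] applies
   one value at a time. *)
congr (lim (_ @ \oo)); apply/funext => n.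
have mfr r : measurable (f_ n @^-1` [set r]) by exact: measurable_sfunP.
under eq_integral do rewrite fimfunE -fsumEFin//.
rewrite ge0_integral_fsum//; last 2 first.
- move=> r; apply/measurable_EFinP/measurable_funTS; apply: measurable_funM => //.
  by apply: measurableT_comp => //; exact: past_of_measurable.
- by move=> r x _; rewrite EFinM nnfun_muleindic_ge0.
under [RHS]eq_integral.
  move=> x _; rewrite fimfunE -fsumEFin// ge0_mule_fsumr; last first.
    by move=> r; rewrite EFinM nnfun_muleindic_ge0.
  over.
rewrite ge0_integral_fsum//; last 2 first.
- move=> r; apply: emeasurable_funM => //; apply/measurable_EFinP.
  apply: measurable_funM => //.
  by apply: measurableT_comp => //; exact: past_of_measurable.
- by move=> r x _; rewrite mule_ge0// EFinM nnfun_muleindic_ge0.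
apply: eq_fsbigr => r rf.
have r0 : 0 <= r by move: rf; rewrite inE => -[x _ <-].
have mF : measurable (@past_of A @^-1` (f_ n @^-1` [set r])).
  exact: preimage_past_measurable.
under eq_integral do rewrite EFinM.
under [RHS]eq_integral do rewrite EFinM muleCA.
rewrite !ge0_integralZl//; last 3 first.
- apply: emeasurable_funM => //; apply/measurable_EFinP.
  by apply: measurableT_comp => //; exact: past_of_measurable.
- by move=> x _; rewrite mule_ge0// lee_fin.
- apply/measurable_EFinP/measurable_funTS.
  by apply: measurableT_comp => //; exact: past_of_measurable.
congr (_ * _)%E.
transitivity (mu (D `&` @past_of A @^-1` (f_ n @^-1` [set r]))).
  by rewrite setIC -integral_indic.
rewrite (mu_P a (mfr r)) [LHS]integral_mkcond; apply: eq_integral => x _.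
rewrite patchE indicE; case: ifPn => xr.
  by rewrite (_ : _ \in _ = true) ?mule1.
by rewrite (_ : _ \in _ = false) ?mule0//; apply/negbTE.
Qed.

End Chain.

Section StringProbability.
Context (R : realType) (N : alphabet_size).
Local Notation A := (alphabet N).

Definition cyl (n : int) (s : seq A) : set (traj A) :=
  [set x | forall i, (i < size s)%N -> x (n + i%:Z) = nth point s i].

Lemma cyl_measurable n s : measurable (cyl n s).
Proof.
apply: measurable_all => i; apply: measurable_imp; exact: coordinate_measurable.
Qed.

Lemma shift_cyl n s : @Defs.shift A @^-1` cyl n s = cyl (n + 1) s.
Proof.
by apply/seteqP; split => x xs i /xs; rewrite /Defs.shift addrAC.
Qed.

Lemma past_of_shift (x : traj A) : past_of (Defs.shift x) = snoc (past_of x) (x 0).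
Proof.
apply/funext => -[|i]; rewrite /past_of /Defs.shift /snoc; congr (x _); lia.
Qed.

Fixpoint string_prob (P : A -> past A -> R) (x : past A) (s : seq A) : R :=
  if s is a :: s' then P a x * string_prob P (snoc x a) s' else 1.

Context (P : A -> past A -> R) (hP : is_kernel P).

Lemma string_prob_ge0 x s : 0 <= string_prob P x s.
Proof.
elim: s x => //= a s IH x; rewrite mulr_ge0//.
by case/andP: (kernel_itv hP a x).
Qed.

Lemma string_prob_measurable s : measurable_fun setT (fun x => string_prob P x s).
Proof.
elim: s => [|a s IH] /=; first exact: measurable_cst.
apply: measurable_funM; first exact: kernel_measurable hP a.
by apply: measurableT_comp IH _; exact: snoc_measurable.
Qed.

Context (mu : probability (traj A) R).
Hypotheses (mu_stat : stationary mu) (mu_P : compatible mu P).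

Lemma stationary_cyl n m s : mu (cyl n s) = mu (cyl m s).
Proof.
have S k : mu (cyl (k + 1) s) = mu (cyl k s).
  by rewrite -shift_cyl; apply: mu_stat; exact: cyl_measurable.
have E k : mu (cyl k s) = mu (cyl 0 s).
  elim/int_rect: k => // k IH; first by rewrite -IH -[RHS]S; congr (mu (cyl _ s)); lia.
  by rewrite -IH -[LHS]S; congr (mu (cyl _ s)); lia.
by rewrite E [RHS]E.
Qed.

Lemma stationary_integral (D : set (traj A)) (f : traj A -> \bar R) :
  measurable D -> measurable_fun D f -> (forall x, 0 <= f x)%E ->
  (\int[mu]_(x in @Defs.shift A @^-1` D) f (Defs.shift x) = \int[mu]_(x in D) f x)%E.
Proof.
move=> mD mf f0; have := ge0_integral_pushforward (@shift_measurable N) mu mD mf.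
move=> <- //; apply: eq_measure_integral => [|? B mB _]; first exact: shift_measurable.
by rewrite /= /pushforward mu_stat.
Qed.

(** Induction on the string with [B] arbitrary: reading the first symbol and shifting time turns it
    into a condition on the past. *)
Lemma string_law (B : set (past A)) s : measurable B ->
  (mu (@past_of A @^-1` B `&` cyl 0 s) =
   \int[mu]_(x in @past_of A @^-1` B) (string_prob P (past_of x) s)%:E)%E.
Proof.
have ms t : measurable_fun setT (fun x : past A => (string_prob P x t)%:E).
  apply/measurable_EFinP; exact: string_prob_measurable.
elim: s B => [|a s IH] B mB.
  rewrite /= integral_cst ?mul1e; last exact: preimage_past_measurable.
  by congr (mu _); apply/setIidPl => x _ i.
pose tail (y : past A) : past A := fun i => y i.+1.
have mtail : measurable_fun setT tail.
  by apply: measurable_fun_seqspace => j b; exact: coordinate_measurable.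
(* After the shift, the events that the past was in [B] and that the symbol [a] followed become the
   single event that the new past is in [B']. *)
pose B' := [set y : past A | y 0%N = a] `&` tail @^-1` B.
have mB' : measurable B'.
  apply: measurableI; first exact: coordinate_measurable.
  by rewrite -[X in measurable X]setTI; exact: mtail.
pose f := (fun y : past A => (string_prob P (snoc y a) s)%:E) \_ B.
have f0 y : (0 <= f y)%E.
  by rewrite /f patchE; case: ifP => // _; rewrite lee_fin string_prob_ge0.
have mf : measurable_fun setT f.
  apply/(measurable_restrictT _ mB)/measurable_funTS.
  by apply: measurableT_comp (ms s) _; exact: snoc_measurable.
have tail_shift x : tail (past_of (Defs.shift x)) = past_of x.
  by rewrite past_of_shift.
have -> : @past_of A @^-1` B `&` cyl 0 (a :: s) =
    @Defs.shift A @^-1` (@past_of A @^-1` B' `&` cyl 0 s).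
  rewrite preimage_setI shift_cyl; apply/seteqP; split => x [Bx xs].
    split; last by move=> i is_; have := xs i.+1 is_; rewrite /= => <-; congr (x _); lia.
    split; first by rewrite past_of_shift; have := xs 0%N isT; rewrite addr0.
    by rewrite /preimage/= tail_shift.
  case: Bx => Bx0; rewrite /preimage/= tail_shift => Bx; split => // -[_|i is_] /=.
    by rewrite addr0 -Bx0 past_of_shift.
  by rewrite -(xs i is_); congr (x _); lia.
rewrite mu_stat; last first.
  apply: measurableI; last exact: cyl_measurable.
  exact: preimage_past_measurable.
rewrite (IH _ mB').
rewrite -(stationary_integral (preimage_past_measurable mB')); last 2 first.
- apply: measurable_funTS; apply: measurableT_comp (ms s) _.
  exact: past_of_measurable.
- by move=> x; rewrite lee_fin string_prob_ge0.
(* The two conditions in [B'] are separated: the last symbol gives the domain of integration,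
   membership in [B] goes into the integrand [f], as [compatible_integral] requires. *)
transitivity (\int[mu]_(x in [set x : traj A | x 0%R = a]) f (past_of x))%E.
  rewrite integral_mkcond [RHS]integral_mkcond; apply: eq_integral => x _.
  rewrite !patchE past_of_shift.
  have [xa|xa] := EM (x 0 = a); last first.
    rewrite [X in _ = if X then _ else _]memNset// memNset//= => -[].
    by rewrite past_of_shift.
  rewrite [X in _ = if X then _ else _]mem_set// /f patchE.
  have [Bx|Bx] := EM (B (past_of x)).
    rewrite [X in _ = if X then _ else _]mem_set// mem_set ?xa//=.
    by split; rewrite /preimage/= ?tail_shift// past_of_shift.
  rewrite [X in _ = if X then _ else _]memNset// memNset//= => -[_].
  by rewrite /preimage/= tail_shift.
rewrite (compatible_integral hP mu_P)// [RHS]integral_mkcond.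
apply: eq_integral => x _; rewrite /f !patchE /=.
have [Bx|Bx] := EM (B (past_of x)).
  by rewrite !mem_set// EFinM.
by rewrite !memNset// mule0.
Qed.

Lemma string_law0 s :
  (mu (cyl 0 s) = \int[mu]_x (string_prob P (past_of x) s)%:E)%E.
Proof. by have := string_law s measurableT; rewrite preimage_setT setTI. Qed.

End StringProbability.

(** * Runs of an update rule and their laws *)

Section Run.
Context (R : realType) (A : pointedType) (G : past A -> R -> A).
Implicit Types (x : past A) (u : int -> R) (m : int) (s t : seq A).

Lemma append_cat x s t : append x (s ++ t) = append (append x s) t.
Proof. exact: foldl_cat. Qed.

Lemma size_run x u m n : size (run G x u m n) = n.
Proof. by elim: n => //= n IH; rewrite size_rcons IH. Qed.

Lemma run_cat x u m n p : run G x u m (n + p) =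
  run G x u m n ++ run G (append x (run G x u m n)) u (m + n%:Z) p.
Proof.
elim: p => [|p IH]; first by rewrite addn0 cats0.
by rewrite addnS /= IH rcons_cat append_cat PoszD addrA.
Qed.

Lemma nth_run a0 x u m n i : (i < n)%N ->
  nth a0 (run G x u m n) i = last a0 (run G x u m i.+1).
Proof.
move=> ltin; rewrite -(subnKC ltin) run_cat nth_cat size_run ltnSn.
by rewrite /= last_rcons nth_rcons size_run ltnn eqxx.
Qed.

Lemma run_shift x u m n c :
  run G x (fun j => u (j + c)) m n = run G x u (m + c) n.
Proof. by elim: n => //= n ->; rewrite addrAC. Qed.

Lemma last_run_default a b x u m n :
  last a (run G x u m n.+1) = last b (run G x u m n.+1).
Proof. by rewrite /= !last_rcons. Qed.

Lemma last_symbolE a x u (n : int) (p : nat) :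
  last_symbol G x u (n - p%:Z) n = last a (run G x u (n - p%:Z) p.+1).
Proof.
rewrite /last_symbol /string gerBl// (_ : absz (n - (n - p%:Z))%R = p); last by lia.
exact: last_run_default.
Qed.

(** On the right, the random past met along the run is replaced by prefixes of the fixed string.
    Each condition then bears on a single innovation, so independence applies. *)
Lemma runP a0 x u m s : run G x u m (size s) = s <->
  forall i, (i < size s)%N -> G (append x (take i s)) (u (m + i%:Z)) = nth a0 s i.
Proof.
elim/last_ind: s => [|s a IH]; first by split.
rewrite size_rcons /=; split.
  move=> /rcons_inj[rs ra] i; rewrite ltnS leq_eqVlt => /predU1P[->|ltis].
    by rewrite -cats1 take_size_cat// nth_cat ltnn subnn/= -ra rs.
  by rewrite -cats1 takel_cat 1?ltnW// nth_cat ltis; exact: (IH.1 rs).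
move=> h; have rs : run G x u m (size s) = s.
  apply/IH => i ltis; have := h i (ltnW ltis).
  by rewrite -cats1 takel_cat 1?ltnW// nth_cat ltis.
rewrite rs; congr rcons; have := h (size s) (ltnSn _).
by rewrite -cats1 take_size_cat// nth_cat ltnn subnn.
Qed.

(** A run started before [j] reaches [j] with some past, and from there on the symbol at 0 is the
    same for all pasts. *)
Lemma Theta0_last u j : Theta0 G u j -> exists a, forall x M,
  (`|j| <= M)%N -> last_symbol G x u (0 - M%:Z) 0 = a.
Proof.
move=> [j0 h]; exists (last_symbol G point u j 0) => x M jM.
rewrite (last_symbolE point) -(subnK jM) -addnS run_cat last_cat.
set y := append x _.
rewrite (_ : 0 - (M - `|j| + `|j|)%N%:Z + (M - `|j|)%N%:Z = 0 - `|j|%N%:Z); last by lia.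
rewrite (last_run_default _ point) -last_symbolE.
by rewrite (_ : 0 - `|j|%N%:Z = j) ?(h _ point)//; lia.
Qed.

End Run.

Section Simulation.
Context (R : realType) (N : alphabet_size).
Local Notation A := (alphabet N).

(** Common interface of [F] and [Fk], so that runs and their limits are studied once for both. The
    past is fixed in both conditions. *)
Record simulates (G : past A -> R -> A) (P : A -> past A -> R) : Prop := {
  simulates_measurable : forall x a, measurable [set u | G x u = a];
  simulates_law : forall x a,
    uniform_prob (@ltr01 R) [set u | G x u = a] = (P a x)%:E }.

Lemma simulates_intro (G : past A -> R -> A) (P : A -> past A -> R) :
  (forall x u, ~~ (0 <= u < 1) -> G x u = x 0%N) ->
  (forall x a, measurable [set u | 0 <= u < 1 /\ G x u = a]) ->
  (forall x a, len [set u | 0 <= u < 1 /\ G x u = a] = (P a x)%:E) ->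
  simulates G P.
Proof.
move=> Gout Gmeas Glaw.
have mI : measurable [set u : R | 0 <= u < 1].
  rewrite (_ : [set u : R | _] = [set` `[0, 1[]); first exact: measurable_itv.
  by apply/seteqP; split => u /=; rewrite in_itv.
have split_fiber x a : [set u | G x u = a] =
    [set u | 0 <= u < 1 /\ G x u = a] `|` (~` [set u : R | 0 <= u < 1] `&` [set u | x 0%N = a]).
  apply/seteqP; split => [u <-|u [[]//|[/negP u01]]] /=.
    have [u01|u01] := boolP (0 <= u < 1); first by left.
    by right; rewrite (Gout _ _ u01); split => //; exact/negP.
  by rewrite (Gout _ _ u01).
have mconst x a : measurable [set u : R | x 0%N = a :> A].
  have [->|ne] := EM (x 0%N = a).
    by rewrite (_ : [set _ | _] = setT)//; apply/seteqP; split.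
  by rewrite (_ : [set _ | _] = set0)//; apply/seteqP; split.
have mout x a : measurable (~` [set u : R | 0 <= u < 1] `&` [set u | x 0%N = a :> A]).
  by apply: measurableI => //; exact: measurableC.
split => x a; rewrite split_fiber; first exact: measurableU.
rewrite measureU; [|exact: Gmeas|exact: mout|]; last first.
  by rewrite -subset0 => u [[u01 _]] [].
rewrite -[RHS]adde0; congr (_ + _)%E.
  by rewrite -Glaw; apply: uniform_prob_len => // u [].
(* What lies outside [0,1[, where [G] takes its default value, is null because [0,1[ has full
   uniform mass. *)
apply/eqP; rewrite -measure_le0.
apply: (@le_trans _ _ (uniform_prob (@ltr01 R) (~` [set u : R | 0 <= u < 1]))).
  by apply: le_measure; rewrite ?inE; [exact: mout|exact: measurableC|exact: subIsetl].
rewrite probability_setC// (_ : _ [set u : R | 0 <= u < 1] = 1%E) ?subee//.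
transitivity (len [set u : R | 0 <= u < 1]); first exact: uniform_prob_len.
rewrite (_ : [set u : R | _] = [set` `[0, 1[]) ?len_itv0//.
Qed.

Context (G : past A -> R -> A) (P : A -> past A -> R) (hG : simulates G P).

Lemma string_probE x s : string_prob P x s =
  \prod_(i < size s) P (nth point s i) (append x (take i s)).
Proof.
elim: s x => [|a s IH] x /=; first by rewrite big_ord0.
by rewrite big_ord_recl/= IH.
Qed.

Context d (T : measurableType d) (Pr : probability T R) (U : int -> {RV Pr >-> R}).
Hypothesis hU : iid_uniform U.

Lemma iid_uniform_window (B : nat -> set R) (m : int) n :
  (forall i, measurable (B i)) ->
  (Pr [set w | forall i, (i < n)%N -> B i (U (m + i%:Z) w)] =
   \prod_(i < n) uniform_prob (@ltr01 R) (B i))%E.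
Proof.
move=> mB.
(* The sets are indexed by offset and independence by time; the distance from [j] to [m] recovers
   the offset inside the window. *)
have := iid_uniform_independent hU [fset (m + (nat_of_ord i)%:Z)%R | i in 'I_n]%fset
  (fun j => mB (absz (j - m)%R)).
rewrite [RHS]big_imfset/=; last first.
  by move=> i j _ _ /addrI[]; exact: val_inj.
rewrite [in RHS]big_enum/= => E; apply: (etrans _ (etrans E _)); last first.
  apply: eq_bigr => i _.
  rewrite -(iid_uniform_law hU (m + i%:Z) (mB i)) /distribution /pushforward.
  by rewrite (_ : absz (m + i%:Z - m)%R = i)//; lia.
congr (Pr _); apply/seteqP; split => w h.
  move=> j /= /imfsetP[i _ ->] /=.
  by rewrite /preimage/= (_ : absz (m + i%:Z - m)%R = i); [exact: h|lia].
move=> i ltin; have := h (m + i%:Z); rewrite /preimage/=.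
rewrite (_ : absz (m + i%:Z - m)%R = i); last by lia.
by apply; apply/imfsetP; exists (Ordinal ltin).
Qed.

Lemma run_law x m s :
  Pr [set w | run G x (fun j => U j w) m (size s) = s] = (string_prob P x s)%:E.
Proof.
pose B i := [set v | G (append x (take i s)) v = nth point s i].
have mB i : measurable (B i) by exact: simulates_measurable hG _ _.
rewrite (_ : [set w | _] =
    [set w | forall i, (i < size s)%N -> B i (U (m + i%:Z) w)]).
  rewrite (iid_uniform_window m (size s) mB) string_probE -prodEFin.
  by apply: eq_bigr => i _; exact: simulates_law hG _ _.
by apply/seteqP; split => w /=; [move/(runP G point)|move=> h; apply/(runP G point)].
Qed.

End Simulation.

(** * Coupling from the past *)

(** Generators of the product sigma-algebra on innovation sequences. Once limits are functions on
    this space, an event can be moved from one time to another by [path_shift]. *)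
Definition real_coordinate_events (R : realType) : set (set (int -> R)) :=
  [set E | exists j (B : set R), measurable B /\ E = [set u | B (u j)]].

Definition useq (R : realType) := g_sigma_algebraType (@real_coordinate_events R).

HB.instance Definition _ (R : realType) := Measurable.on (useq R).

Lemma measurable_fiber d (X : measurableType d) (T : countType) (f : X -> T)
    (Q : T -> Prop) :
  (forall t, measurable [set x | f x = t]) -> measurable [set x | Q (f x)].
Proof.
move=> mf; rewrite (_ : [set x | _] = \bigcup_(t in [set t | Q t]) [set x | f x = t]).
  by apply: countable_bigcup_measurable => t _; exact: mf.
by apply/seteqP; split => [x Qx|x [t /= Qt fx]]; [exists (f x)|rewrite /= fx].
Qed.

Lemma measurable_and_prop d (X : measurableType d) (Q S : X -> Prop) :
  measurable [set x | Q x] -> measurable [set x | S x] ->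
  measurable [set x | Q x /\ S x].
Proof. exact: measurableI. Qed.

Lemma measurable_or_prop d (X : measurableType d) (Q S : X -> Prop) :
  measurable [set x | Q x] -> measurable [set x | S x] ->
  measurable [set x | Q x \/ S x].
Proof. exact: measurableU. Qed.

Lemma measurable_prop d (X : measurableType d) (Q : Prop) :
  measurable [set x : X | Q].
Proof.
have [q|nq] := EM Q.
  by rewrite (_ : [set _ | _] = setT)//; apply/seteqP; split.
by rewrite (_ : [set _ | _] = set0)//; apply/seteqP; split.
Qed.

Section UniformSequences.
Context (R : realType).

Lemma useq_coord_measurable j (B : set R) : measurable B ->
  measurable [set u : useq R | B (u j)].
Proof. by move=> mB; apply: sub_sigma_algebra; exists j, B. Qed.

Lemma measurable_fun_useq d (X : measurableType d) (f : X -> useq R) :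
  (forall j (B : set R), measurable B -> measurable [set w | B (f w j)]) ->
  measurable_fun setT f.
Proof.
move=> mf.
apply: (@measurability _ _ X (useq R) setT f (@real_coordinate_events R)) => //.
by move=> _ [_ [j [B [mB ->]]] <-]; rewrite setTI; exact: mf.
Qed.

Lemma shift_useq_measurable n :
  measurable_fun setT (fun u : useq R => (fun j => u (j + n)) : useq R).
Proof. by apply: measurable_fun_useq => j B mB; exact: useq_coord_measurable. Qed.

Definition rectangles : set (set (useq R)) :=
  [set E | exists (S : {fset int}) (B : int -> set R),
    (forall j, measurable (B j)) /\ E = [set u | forall j, j \in S -> B j (u j)]].

Lemma rectangles_measurable E : rectangles E -> measurable E.
Proof.
move=> [S [B [mB ->]]].
by apply: measurable_all => j; apply: measurable_imp; exact: useq_coord_measurable.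
Qed.

Lemma rectangles_generate : @measurable _ (useq R) = <<s rectangles >>.
Proof.
apply/seteqP; split.
  apply: smallest_sub; first exact: smallest_sigma_algebra.
  move=> _ [j [B [mB ->]]]; apply: sub_sigma_algebra.
  exists [fset j]%fset, (fun=> B); split => //.
  by apply/seteqP; split => u /=; [move=> Bu i /fset1P ->|apply; exact/fset1P].
apply: smallest_sub; first exact: sigma_algebra_measurable.
exact: rectangles_measurable.
Qed.

Lemma rectanglesI : setI_closed rectangles.
Proof.
move=> _ _ [S [B [mB ->]]] [S' [B' [mB' ->]]].
exists (S `|` S')%fset, (fun j => [set v | (j \in S -> B j v) /\ (j \in S' -> B' j v)]).
split.
  by move=> j; apply: measurable_and_prop; apply: measurable_imp; [exact: mB|exact: mB'].
apply/seteqP; split => u /=; first by move=> [h h'] j _; split; [exact: h|exact: h'].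
move=> h; split => j jS.
  by have /(_ _)/= [] := h j; rewrite ?inE ?jS// => + _; exact.
by have /(_ _)/= [] := h j; rewrite ?inE ?jS ?orbT// => _; exact.
Qed.

Context d (T : measurableType d) (Pr : probability T R).
Context (U : int -> {RV Pr >-> R}).
Hypothesis hU : iid_uniform U.

Lemma path_measurable (n : int) :
  measurable_fun setT (fun w => (fun j => U (j + n) w) : useq R).
Proof.
apply: measurable_fun_useq => j B mB.
by rewrite -[X in measurable X]setTI; exact: (measurable_funP (U (j + n))).
Qed.

Lemma iid_uniform_rectangle (n : int) (S : {fset int}) (B : int -> set R) :
  (forall j, measurable (B j)) ->
  (Pr [set w | forall j, j \in S -> B j (U (j + n) w)] =
   \prod_(j <- S) uniform_prob (@ltr01 R) (B j))%E.
Proof.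
move=> mB.
have := iid_uniform_independent hU [fset (j + n)%R | j in S]%fset
  (fun j => mB (j - n)).
rewrite [RHS]big_imfset/=; last by move=> i j _ _ /addIr.
move=> E; apply: (etrans _ (etrans E _)); last first.
  apply: eq_bigr => i _.
  by rewrite -(iid_uniform_law hU (i + n) (mB i)) /distribution /pushforward addrK.
congr (Pr _); apply/seteqP; split => w h.
  by move=> j /= /imfsetP[i iS ->] /=; rewrite /preimage/= addrK; exact: h.
move=> j jS; have := h (j + n); rewrite /preimage/= addrK.
by apply; apply/imfsetP; exists j.
Qed.

(** The laws of the shifted and unshifted innovations agree on [rectangles], where independence
    gives the same product for both; these form a generating pi-system. *)
Lemma path_shift (C : set (useq R)) (n : int) : measurable C ->
  Pr [set w | C (fun j => U (j + n) w)] = Pr [set w | C (fun j => U j w)].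
Proof.
move=> mC.
have -> : [set w | C (fun j => U j w)] = [set w | C (fun j => U (j + 0) w)].
  have E w : (fun j => U (j + 0) w) = (fun j => U j w).
    by apply/funext => j; rewrite addr0.
  by apply/seteqP; split => w /=; rewrite E.
pose X m : {mfun T >-> useq R} := mfun_Sub (mem_set (path_measurable m)).
apply: (@measure_unique _ R (useq R) rectangles (fun=> setT)
  rectangles_generate rectanglesI _ _ (distribution Pr (X n))
  (distribution Pr (X 0)) _ _ C mC).
- move=> _; exists fset0, (fun=> setT); split => //.
  by apply/seteqP; split.
- by rewrite bigcup_const.
- move=> _ [S [B [mB ->]]].
  transitivity (\prod_(j <- S) uniform_prob (@ltr01 R) (B j))%E.
    exact: iid_uniform_rectangle.
  by symmetry; exact: iid_uniform_rectangle.
- by move=> _; rewrite -ge0_fin_numE//; exact: fin_num_measure.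
Qed.

End UniformSequences.

Lemma ge0_integral_esum d (X : measurableType d) (R : realType)
    (m : {measure set X -> \bar R}) (T : countType) (f : T -> X -> \bar R) :
  (forall t, measurable_fun setT (f t)) -> (forall t x, 0 <= f t x)%E ->
  (\int[m]_x (\esum_(t in [set: T]) f t x) =
   \esum_(t in [set: T]) \int[m]_x f t x)%E.
Proof.
move=> mf f0; under eq_integral do rewrite esum_countable//.
rewrite integral_nneseries// => [|n|n x _]; last 2 first.
- by case: pickle_inv.
- by case: pickle_inv.
rewrite esum_countable => [|t]; last exact: integral_ge0.
apply: eq_eseriesr => n _; case: pickle_inv => //.
by rewrite integral0.
Qed.

Lemma esum_measurable d (X : measurableType d) (R : realType) (T : countType)
    (f : T -> X -> \bar R) :
  (forall t, measurable_fun setT (f t)) -> (forall t x, 0 <= f t x)%E ->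
  measurable_fun setT (fun x => \esum_(t in [set: T]) f t x).
Proof.
move=> mf f0; under eq_fun do rewrite esum_countable//.
apply: (@ge0_emeasurable_sum _ _ _ _ _ xpredT) => [n x _ _|n _]; by case: pickle_inv.
Qed.

(** * The limit trajectory and its law *)

Section CouplingFromThePast.
Context (R : realType) (N : alphabet_size).
Local Notation A := (alphabet N).
Context (G : past A -> R -> A) (P : A -> past A -> R).
Hypotheses (hG : simulates G P) (hP : is_kernel P).

Lemma run_measurable (x : past A) (m : int) n s :
  measurable [set u : useq R | run G x u m n = s].
Proof.
have [<-|ns] := EM (size s = n); last first.
  rewrite (_ : [set _ | _] = set0)//; apply/seteqP; split => u // us.
  by apply: ns; rewrite -us size_run.
rewrite (_ : [set _ | _] = [set u : useq R | forall i, (i < size s)%N ->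
    G (append x (take i s)) (u (m + i%:Z)) = nth point s i]).
  apply: measurable_all => i; apply: measurable_imp.
  apply: (@useq_coord_measurable _ _
    [set v | G (append x (take i s)) v = nth point s i]).
  exact: simulates_measurable hG _ _.
by apply/seteqP; split => u /=; [move/(runP G point)|move=> h; apply/(runP G point)].
Qed.

Definition eventually_last (x : past A) (a : A) (u : int -> R) :=
  exists K, forall M : nat, (K <= M)%N -> last_symbol G x u (0 - M%:Z) 0 = a.

(** Runs from the single past [point] are used, which keeps the definition measurable. The other
    [point] is the default symbol when these runs do not stabilise. *)
Definition origin_symbol (u : int -> R) : A :=
  xget point [set a | eventually_last point a u].

Definition limit_traj (u : int -> R) : traj A :=
  fun n => origin_symbol (fun j => u (j + n)).

Lemma eventually_last_inj (x : past A) (a b : A) (u : int -> R) :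
  eventually_last x a u -> eventually_last x b u -> a = b.
Proof.
move=> [K hK] [L hL]; rewrite -(hK (maxn K L)) ?leq_maxl//.
by rewrite hL ?leq_maxr.
Qed.

Lemma eventually_last_measurable (x : past A) (a : A) :
  measurable [set u : useq R | eventually_last x a u].
Proof.
apply: measurable_ex => K; apply: measurable_all => M; apply: measurable_imp.
under eq_set do rewrite (last_symbolE _ point).
apply: (@measurable_fiber _ _ (seq A) (fun u : useq R => run G x u (0 - M%:Z) M.+1)
  (fun t => last point t = a)).
by move=> t; exact: run_measurable.
Qed.

Lemma origin_symbolE (u : int -> R) (a : A) :
  eventually_last point a u -> origin_symbol u = a.
Proof.
move=> h; rewrite /origin_symbol; case: xgetP => [b _ hb|/(_ a)//].
exact: eventually_last_inj hb h.
Qed.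

Lemma origin_symbol_measurable (a : A) :
  measurable [set u : useq R | origin_symbol u = a].
Proof.
rewrite (_ : [set _ | _] = [set u : useq R | eventually_last point a u \/
    (~ (exists b, eventually_last point b u)) /\ a = point]).
  apply: measurable_or_prop; first exact: eventually_last_measurable.
  apply: measurable_and_prop; last exact: measurable_prop.
  apply: measurableC; apply: measurable_ex => b; exact: eventually_last_measurable.
apply/seteqP; split => u /=; last first.
  move=> [h|[h ->]]; first exact: origin_symbolE.
  by rewrite /origin_symbol; case: xgetP => // b _ hb; case: h; exists b.
move=> <-; rewrite /origin_symbol; case: xgetP => [b _ hb|h]; [left|right] => //.
by split => // -[b hb]; exact: (h b).
Qed.

Lemma limit_traj_measurable : measurable_fun setT (limit_traj : useq R -> traj A).
Proof.
apply: measurable_fun_seqspace => n a.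
have := shift_useq_measurable n measurableT (origin_symbol_measurable a).
by rewrite setTI.
Qed.

Lemma Theta0_origin u j : Theta0 G u j ->
  (forall x, eventually_last x (origin_symbol u) u) /\
  (forall x, last_symbol G x u j 0 = origin_symbol u).
Proof.
move=> hj; have [a ha] := Theta0_last hj.
have ev x : eventually_last x a u by exists `|j|%N => M; exact: ha.
rewrite (origin_symbolE (ev point)); split => // x.
have [j0 _] := hj; rewrite -(ha x `|j|%N)//.
by congr last_symbol; lia.
Qed.

Context d (T : measurableType d) (Pr : probability T R) (U : int -> {RV Pr >-> R}).
Hypothesis hU : iid_uniform U.
Local Notation path w := (fun n => U n w).
Hypothesis hTheta : {ae Pr, forall w, Theta0 G (path w) !=set0}.

Lemma path_measurable0 (C : set (useq R)) : measurable C ->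
  measurable [set w | C (path w)].
Proof.
move=> mC; have := path_measurable U 0 measurableT mC; rewrite setTI.
rewrite (_ : _ @^-1` _ = [set w | C (path w)])//.
have E w : (fun j => U (j + 0) w) = path w.
  by apply/funext => j; rewrite addr0.
by apply/seteqP; split => w /=; rewrite E.
Qed.

(* [Theta0] quantifies over uncountably many pasts, so its events need not be
   measurable; stabilisation of the runs from one fixed past is. *)
Lemma limit_traj_ae (x : past A) (n : int) :
  {ae Pr, forall w, eventually_last x (limit_traj (path w) n) (fun j => U (j + n) w)}.
Proof.
pose C := [set u : useq R | eventually_last x (origin_symbol u) u].
have mC : measurable C.
  rewrite (_ : C = [set u | exists a, eventually_last x a u /\ origin_symbol u = a]).
    apply: measurable_ex => a; apply: measurable_and_prop.
      exact: eventually_last_measurable.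
    exact: origin_symbol_measurable.
  by apply/seteqP; split => u; [exists (origin_symbol u)|move=> [a [h oa]]; rewrite /C/= oa].
exists [set w | (~` C) (fun j => U (j + n) w)]; split => //.
- have := path_measurable U n measurableT (measurableC mC).
  by rewrite setTI.
- rewrite (path_shift hU n (measurableC mC)).
  have [M [mM M0 hM]] := hTheta.
  apply: (subset_measure0 _ mM _ M0); first exact: path_measurable0 (measurableC mC).
  move=> w /= nC; apply: hM => -[j hj]; apply: nC.
  by have [h _] := Theta0_origin hj; exact: h.
Qed.

(** Each symbol in the final window of a run is itself the last symbol of a shorter run. Recentred
    at the origin, it is of the kind whose stabilisation is known. *)
Lemma drop_run_eq (x : past A) (n : int) (M : nat) (s : seq A) u :
  drop M (run G x u (n - M%:Z) (M + size s)) = s <->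
  forall i, (i < size s)%N ->
    last_symbol G x (fun j => u (j + (n + i%:Z))) (0 - (M + i)%N%:Z) 0 = nth point s i.
Proof.
have nthE i : (i < size s)%N ->
    nth point (drop M (run G x u (n - M%:Z) (M + size s))) i =
    last_symbol G x (fun j => u (j + (n + i%:Z))) (0 - (M + i)%N%:Z) 0.
  move=> is_; rewrite nth_drop nth_run ?ltn_add2l//.
  rewrite (last_symbolE _ point) run_shift; congr (last _ (run _ _ _ _ _)); lia.
split => [h i is_|h]; first by rewrite -nthE// h.
apply: (@eq_from_nth _ point).
  by rewrite size_drop size_run addKn.
move=> i; rewrite size_drop size_run addKn => is_.
by rewrite nthE// h.
Qed.

Lemma drop_run_measurable (x : past A) (n : int) (M : nat) s :
  measurable [set w | drop M (run G x (path w) (n - M%:Z) (M + size s)) = s].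
Proof.
apply: (@path_measurable0
  [set u | drop M (run G x u (n - M%:Z) (M + size s)) = s]).
apply: (@measurable_fiber _ _ (seq A)
  (fun u : useq R => run G x u (n - M%:Z) (M + size s)) (fun t => drop M t = s)).
by move=> t; exact: run_measurable.
Qed.

Lemma limit_cyl_measurable (n : int) (s : seq A) :
  measurable [set w | cyl n s (limit_traj (path w))].
Proof.
apply: (@path_measurable0 (limit_traj @^-1` cyl n s)).
rewrite -[X in measurable X]setTI; apply: limit_traj_measurable => //.
exact: cyl_measurable.
Qed.

(** A window has finitely many coordinates, each almost surely stabilising; the indicators are then
    eventually constant and bounded by 1. *)
Lemma drop_run_cvg (x : past A) (n : int) (s : seq A) :
  (fun M => Pr [set w | drop M (run G x (path w) (n - M%:Z) (M + size s)) = s])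
    @ \oo --> Pr [set w | cyl n s (limit_traj (path w))].
Proof.
pose E M := [set w | drop M (run G x (path w) (n - M%:Z) (M + size s)) = s].
pose F := [set w | cyl n s (limit_traj (path w))].
have mE M : measurable (E M) by exact: drop_run_measurable.
have mF : measurable F by exact: limit_cyl_measurable.
have IE (B : set T) : measurable B -> Pr B = (\int[Pr]_w (\1_B w)%:E)%E.
  by move=> mB; rewrite integral_indic// setIT.
suff : (fun M => (\int[Pr]_w (\1_(E M) w)%:E)%E) @ \oo --> (\int[Pr]_w (\1_F w)%:E)%E.
  rewrite -(IE F mF); apply: cvg_trans; apply: near_eq_cvg.
  by apply: nearW => M; exact: esym (IE (E M) (mE M)).
have [] := @dominated_convergence _ T R Pr setT measurableT
  (fun M w => (\1_(E M) w)%:E) (fun w => (\1_F w)%:E) (cst 1%E); last by [].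
- by move=> M; exact/measurable_EFinP/measurable_indic.
- exact/measurable_EFinP/measurable_indic.
- have := ae_foralln (fun i => limit_traj_ae x (n + i%:Z)).
  apply: filterS => w /choice[K hK] _.
  (* Beyond the largest of the stabilisation ranks [K i], all coordinates have settled, since the
     run ending at the i-th one starts M + i steps earlier. *)
  apply: cvg_near_cst; exists (\max_(i < size s) K i)%N => // M /= KM.
  congr (_%:E); rewrite !indicE; congr (_%:R); congr nat_of_bool.
  apply/idP/idP; rewrite !inE /E /F /= => h.
    move=> i is_; have := (drop_run_eq x n M s _).1 h i is_.
    rewrite (hK i)//; apply: leq_trans (leq_addr _ _); apply: leq_trans KM.
    exact: (leq_bigmax (Ordinal is_)).
  apply/drop_run_eq => i is_; rewrite -(h i is_); apply: hK.
  apply: leq_trans (leq_addr _ _); apply: leq_trans KM.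
  exact: (leq_bigmax (Ordinal is_)).
- exact: finite_measure_integrable_cst.
- by apply: aeW => w M _; rewrite /= indicE normr_nat; case: (_ \in _).
Qed.

Lemma drop_run_law (x : past A) (n : int) (M : nat) (s : seq A) :
  Pr [set w | drop M (run G x (path w) (n - M%:Z) (M + size s)) = s] =
  (\esum_(t in [set: M.-tuple A]) (string_prob P x (t ++ s))%:E)%E.
Proof.
pose E (t : M.-tuple A) :=
  [set w | run G x (path w) (n - M%:Z) (M + size s) = t ++ s].
have mE t : measurable (E t).
  by apply: (@path_measurable0 [set u | run G x u _ _ = _]); exact: run_measurable.
rewrite (_ : [set w | _] = \bigcup_(t in [set: M.-tuple A]) E t); last first.
  apply/seteqP; split => [w /= h|w [t _]]; last first.
    by rewrite /E /= => ->; rewrite drop_size_cat// size_tuple.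
  have sz : size (take M (run G x (path w) (n - M%:Z) (M + size s))) == M.
    by rewrite size_take size_run; case: ltnP => //; lia.
  by exists (Tuple sz) => //; rewrite /E /= -{3}h cat_take_drop.
rewrite measure_countable_bigcup//; last first.
  move=> t t' _ _ [w []]; rewrite /E /= => -> /eqP.
  by rewrite eqseq_cat ?size_tuple// => /andP[/eqP/val_inj].
apply: eq_esum => t _; rewrite -(run_law hG hU x (n - M%:Z)).
by congr (Pr _); rewrite /E size_cat size_tuple.
Qed.

Context (mu : probability (traj A) R).
Hypotheses (mu_stat : stationary mu) (mu_P : compatible mu P).

(** Counterpart of [drop_run_law] for [mu]: the M symbols preceding the window are summed out, after
    stationarity has placed them at times 0 to M - 1. *)
Lemma cyl_esum (n : int) (M : nat) (s : seq A) :
  mu (cyl n s) = (\esum_(t in [set: M.-tuple A]) mu (cyl 0 (t ++ s)))%E.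
Proof.
rewrite (stationary_cyl mu_stat n M%:Z s).
rewrite (_ : cyl M%:Z s = \bigcup_(t in [set: M.-tuple A]) cyl 0 (t ++ s)).
  rewrite measure_countable_bigcup// => [t _|]; first exact: cyl_measurable.
  move=> t t' _ _ [x [xt xt']]; apply/val_inj/(@eq_from_nth _ point).
    by rewrite !size_tuple.
  move=> i it.
  have := xt i; have := xt' i; rewrite !size_cat !nth_cat it.
  rewrite size_tuple in it.
  by rewrite !size_tuple it => <- => [<-//|]; rewrite ltn_addr.
apply/seteqP; split => x.
  move=> xs; exists [tuple x (val i)%:Z | i < M] => // i.
  rewrite size_cat size_tuple nth_cat size_tuple add0r => iMs.
  case: (ltnP i M) => [iM|Mi].
    have := tnth_nth point [tuple x (val i)%:Z | i < M] (Ordinal iM).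
    by rewrite tnth_mktuple.
  by rewrite -xs; [congr (x _); lia|lia].
move=> [t _ xt] i is_; have := xt (M + i)%N.
rewrite size_cat size_tuple ltn_add2l => /(_ is_).
rewrite nth_cat size_tuple ifN ?addKn => [<-|]; last by rewrite -leqNgt leq_addr.
by congr (x _); lia.
Qed.

(** [p M x] is the probability of seeing [s] after M symbols from the past [x]. Its [mu]-integral is
    the left side for every M, while it converges pointwise to the right side, a constant in [x]. *)
Lemma cyl_limit (n : int) (s : seq A) :
  mu (cyl n s) = Pr [set w | cyl n s (limit_traj (path w))].
Proof.
pose p M (x : past A) := (\esum_(t in [set: M.-tuple A]) (string_prob P x (t ++ s))%:E)%E.
set q := Pr _.
have pq x : p ^~ x @ \oo --> q.
  rewrite (_ : p ^~ x = fun M => Pr [set w |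
    drop M (run G x (path w) (n - M%:Z) (M + size s)) = s]); first exact: drop_run_cvg.
  by apply/funext => M; rewrite (drop_run_law x n M s).
have p0 M x : (0 <= p M x)%E.
  by apply: esum_ge0 => t _; rewrite lee_fin (string_prob_ge0 hP).
have p1 M x : (p M x <= 1)%E.
  by rewrite /p -(drop_run_law x n M s); apply: probability_le1; exact: drop_run_measurable.
have ms (t : seq A) : measurable_fun setT (fun x : traj A => (string_prob P (past_of x) t)%:E).
  apply/measurable_EFinP; apply: measurableT_comp (string_prob_measurable hP t) _.
  exact: past_of_measurable.
have mp M : measurable_fun setT (fun x : traj A => p M (past_of x)).
  apply: esum_measurable => [t|t x]; first exact: ms.
  by rewrite lee_fin (string_prob_ge0 hP).
(* The summed string probabilities integrate to cylinder probabilities of [mu], and these add up to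
   the same value whatever M is. *)
have int_p M : (\int[mu]_x p M (past_of x) = mu (cyl n s))%E.
  rewrite ge0_integral_esum => [|t|t x]; last 2 first.
  - exact: ms.
  - by rewrite lee_fin (string_prob_ge0 hP).
  by rewrite (cyl_esum n M s); apply: eq_esum => t _; rewrite (string_law0 hP mu_stat mu_P).
have [] := @dominated_convergence _ _ R mu setT measurableT
  (fun M x => p M (past_of x)) (cst q) (cst 1%E).
- exact: mp.
- exact: measurable_cst.
- by apply: aeW => x _; exact: pq.
- exact: finite_measure_integrable_cst.
- by apply: aeW => x M _; rewrite gee0_abs.
move=> _ _; rewrite (_ : (\int[mu]_x cst q x = q)%E); last first.
  rewrite integral_cst// -[RHS]mule1; congr (_ * _)%E; exact: probability_setT.
rewrite (_ : [sequence _]_M = fun=> mu (cyl n s)); last by apply/funext => M; exact: int_p.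
by move=> qmu; apply: (cvg_unique (@ereal_hausdorff R) _ qmu); exact: cvg_cst.
Qed.

End CouplingFromThePast.

(** * Cylinders determine the law of a trajectory *)

Section TrajectoryLaw.
Context (R : realType) (N : alphabet_size).
Local Notation A := (alphabet N).

(* The windows [-m, m[ are nested, which makes their cylinders a pi-system. *)
Definition windows : set (set (traj A)) :=
  [set E | E = set0 \/
    exists (m : nat) (s : seq A), size s = m.*2 /\ E = cyl (- m%:Z) s].

Lemma windows_measurable E : windows E -> measurable E.
Proof. by move=> [->|[m [s [_ ->]]]]; [exact: measurable0|exact: cyl_measurable]. Qed.

Lemma windows_generate : @measurable _ (traj A) = <<s windows >>.
Proof.
apply/seteqP; split; last first.
  apply: smallest_sub; first exact: sigma_algebra_measurable.
  exact: windows_measurable.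
apply: smallest_sub; first exact: smallest_sigma_algebra.
(* This [m] puts the time [j] inside the window, at position j + m of the string. *)
move=> _ [j [a ->]]; pose m := (`|j|%N).+1.
have -> : [set x : int -> A | x j = a] =
  \bigcup_(s in [set s : m.*2.-tuple A | nth point s `|(j + m%:Z)%R|%N = a]) cyl (- m%:Z) s.
  have jm : (`|(j + m%:Z)%R|%N < m.*2)%N by rewrite /m; lia.
  have jE : - m%:Z + `|(j + m%:Z)%R|%N%:Z = j by rewrite /m; lia.
  apply/seteqP; split => x.
    move=> xj; pose t := [tuple x (- m%:Z + (val i)%:Z) | i < m.*2].
    have tE i (im : (i < m.*2)%N) : nth point t i = x (- m%:Z + i%:Z).
      by have := tnth_nth point t (Ordinal im); rewrite tnth_mktuple.
    exists t; first by rewrite /= tE// jE.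
    by move=> i; rewrite size_tuple => im; rewrite tE.
  move=> [s /= sa xs].
  by have := xs `|(j + m%:Z)%R|%N; rewrite size_tuple jE sa; apply.
pose S := g_sigma_algebraType windows.
apply: (@countable_bigcup_measurable _ S).
move=> s _; apply: sub_sigma_algebra; right; exists m, s.
by rewrite size_tuple.
Qed.

Lemma windowsI : setI_closed windows.
Proof.
have nested m s m' s' : size s = m.*2 -> size s' = m'.*2 -> (m <= m')%N ->
    windows (cyl (- m%:Z) s `&` cyl (- m'%:Z) s').
  move=> sm sm' mm'; have [[x [xs xs']]|ne] := EM (cyl (- m%:Z) s `&` cyl (- m'%:Z) s' !=set0).
    (* Two windows with a common trajectory carry compatible strings, so the wider cylinder is
       contained in the narrower one; m' - m is the offset between their left ends. *)
    right; exists m', s'; split => //; apply/setIidPr => y ys' i is_.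
    rewrite -(xs i is_).
    have ltim' : (i + (m' - m) < size s')%N by rewrite sm'; move: is_; rewrite sm; lia.
    have iE : - m'%:Z + (i + (m' - m))%N%:Z = - m%:Z + i%:Z by lia.
    by have := ys' _ ltim'; rewrite -(xs' _ ltim') iE.
  by left; rewrite -subset0 => x xss; apply: ne; exists x.
move=> E E' [->|[m [s [sm ->]]]]; first by rewrite set0I; left.
move=> [->|[m' [s' [sm' ->]]]]; first by rewrite setI0; left.
have [mm'|mm'] := leqP m m'; first exact: nested.
by rewrite setIC; apply: nested => //; exact: ltnW.
Qed.

Lemma traj_law_eq (mu nu : probability (traj A) R) :
  (forall n s, mu (cyl n s) = nu (cyl n s)) ->
  forall B, measurable B -> mu B = nu B.
Proof.
move=> mu_nu B mB.
apply: (@measure_unique _ R (traj A) windows (fun=> setT) windows_generate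
  windowsI _ _ mu nu _ _ B mB).
- move=> _; right; exists 0%N, [::]; split => //.
  by apply/seteqP; split.
- by rewrite bigcup_const.
- by move=> _ [->|[m [s [_ ->]]]]; [rewrite !measure0|exact: mu_nu].
- by move=> _; rewrite -ge0_fin_numE//; exact: fin_num_measure.
Qed.

End TrajectoryLaw.

(** * How far runs depend on the last k symbols of the initial past *)

Section Locality.
Context (R : realType) (N : alphabet_size).
Local Notation A := (alphabet N).
Context (P : A -> past A -> R) (I : past A -> enat -> A -> set R).
Hypothesis hI : is_range_partition P I.
Context (k : nat).
Implicit Types (x y : past A) (u : int -> R) (m : int).

Lemma recent_append_eq x y (s : seq A) : recent k x = recent k y ->
  recent k (append x s) = recent k (append y s).
Proof.
move=> xy; apply: eq_from_tnth => i; rewrite !tnth_mktuple !(appendE point).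
case: ltnP => // si.
have ik : (rev_ord i - size s < k)%N by have := ltn_ord (rev_ord i); lia.
have := congr1 (fun t => tnth t (rev_ord (Ordinal ik))) xy.
by rewrite !tnth_mktuple rev_ordK.
Qed.

(** Time is counted in steps from the start [m], so that a first exceedance can be chosen as a
    minimum. *)
Definition exceeds x u m n :=
  enat_lt (Some k) (L I (append x (run (F I) x u m n)) (u (m + n%:Z))).

Lemma run_local x y u m n : (forall j, 0 <= u j < 1) -> recent k x = recent k y ->
  (forall i, (i < n)%N -> ~~ exceeds x u m i) ->
  run (F I) x u m n = run (F I) y u m n.
Proof.
move=> u01 xy; elim: n => //= n IH nex.
have rE : run (F I) x u m n = run (F I) y u m n.
  by apply: IH => i ltin; apply: nex; exact: ltnW.
rewrite -rE /F (LF_local hI (u01 _) (recent_append_eq _ xy))//.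
exact: nex.
Qed.

(** Up to the first exceedance the two runs agree, hence it occurs at the same step for both.
    Afterwards they may differ, which is why the step [p] can be smaller than [n]. *)
Lemma exceeds_local x y u m n : (forall j, 0 <= u j < 1) -> recent k x = recent k y ->
  exceeds x u m n -> exists2 p, (p <= n)%N & exceeds y u m p.
Proof.
move=> u01 xy xn; have ex : exists p, exceeds x u m p by exists n.
case: (ex_minnP ex) => p xp pmin; exists p; first exact: pmin.
rewrite /exceeds -(run_local u01 xy) => [|i ip].
  by rewrite -(L_local hI (u01 _) (recent_append_eq _ xy)).
by apply/negP => /pmin; rewrite leqNgt ip.
Qed.

Lemma run_Fk (Pk : A -> k.-tuple A -> R) x u m n :
  (forall a x, (kept_len k I x a <= (Pk a (recent k x))%:E)%E) ->
  (forall j, 0 <= u j < 1) ->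
  (forall i, (i < n)%N -> ~~ exceeds x u m i) ->
  run (Fk Pk I) x u m n = run (F I) x u m n.
Proof.
move=> kept u01; elim: n => //= n IH nex.
rewrite IH => [|i ltin]; last by apply: nex; exact: ltnW.
by rewrite (Fk_F hI kept (u01 _))//; exact: nex.
Qed.

(** For i = m the string is empty by convention, in accordance with a run of zero steps. *)
Lemma string_run x u m i : m <= i ->
  string (F I) x u m (i - 1) = run (F I) x u m `|(i - m)%R|%N.
Proof.
move=> mi; rewrite /string; case: ifPn => [mi1|mi1].
  by congr run; lia.
by rewrite (_ : `|(i - m)%R|%N = 0%N)//; lia.
Qed.

Lemma exceeds_string x u m i : m <= i ->
  enat_lt (Some k) (L I (append x (string (F I) x u m (i - 1))) (u i)) =
  exceeds x u m `|(i - m)%R|%N.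
Proof.
move=> mi; rewrite string_run// /exceeds; congr (enat_lt _ (L _ _ (u _))); lia.
Qed.

End Locality.

(** * The coupling of the chain with its Markov approximation *)

Section Coupling.
Context (R : realType) (N : alphabet_size).
Local Notation A := (alphabet N).
Context (P : A -> past A -> R) (I : past A -> enat -> A -> set R).
Hypothesis hI : is_range_partition P I.

Lemma simulates_F : simulates (F I) P.
Proof.
apply: simulates_intro => [x u u01|x a|x a]; last exact: F_law hI x a.
  by rewrite /F (LF_out hI).
exact: F_fiber_measurable hI x a.
Qed.

Context (mu : probability (traj A) R) (hP : is_kernel P).
Hypotheses (mu_stat : stationary mu) (mu_P : compatible mu P).
Context (k : nat) (Pk : A -> k.-tuple A -> R).
Hypothesis hPk : is_markov_kernel P mu Pk.

Let kept_le := kept_len_le_markov hP mu_P hPk hI.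
Let Pk_sum := markov_kernel_sum hPk.

Lemma simulates_Fk : simulates (Fk Pk I) (fun a x => Pk a (recent k x)).
Proof.
apply: simulates_intro => [x u u01|x a|x a].
- rewrite /Fk; case: xgetP => // a _ [[j _ Ij]|Mj].
    by move: u01; rewrite (range_itv_bounded hI Ij).
  by move: u01; rewrite (markov_itv_bounded hI Pk_sum kept_le Mj).
- by have := Fk_fiber_measurable hI Pk_sum kept_le x a.
- by have := Fk_law hI Pk_sum kept_le x a.
Qed.

(** Measurability holds because the kernel factors through the countable set of strings of length k;
    the bound by 1 compares one term with the whole sum. *)
Lemma markov_is_kernel : is_kernel (fun a x => Pk a (recent k x)).
Proof.
split.
- move=> a; apply: (measurable_fun_countable (Pk a)) => s; exact: recent_measurable.
- move=> a x; rewrite (markov_kernel_ge0 hPk)/= -lee_fin -(Pk_sum (recent k x)).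
  apply: esum_ge; exists [set a]; first by split.
  by rewrite fsbig_set1.
- by move=> x; exact: Pk_sum.
Qed.

Context d (T : measurableType d) (Pr : probability T R) (U : int -> {RV Pr >-> R}).
Hypothesis hU : iid_uniform U.
Local Notation path w := (fun n => U n w).

Lemma limit_path_measurable G Q : simulates G Q ->
  measurable_fun setT (fun w => limit_traj G (path w) : traj A).
Proof.
move=> hG _ B mB; rewrite setTI.
apply: (@path_measurable0 _ _ _ _ U (limit_traj G @^-1` B)).
by have := limit_traj_measurable hG measurableT mB; rewrite setTI.
Qed.

Lemma limit_path_law G Q nu : simulates G Q -> is_kernel Q ->
  stationary nu -> compatible nu Q ->
  {ae Pr, forall w, Theta0 G (path w) !=set0} ->
  forall B : set (traj A), measurable B ->
    nu B = Pr [set w | B (limit_traj G (path w))].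
Proof.
move=> hG hQ nu_stat nu_Q hT B mB.
pose X : {mfun T >-> traj A} := mfun_Sub (mem_set (limit_path_measurable hG)).
apply: (@traj_law_eq _ _ nu (distribution Pr X)) => // n s.
exact: (cyl_limit hG hQ hU hT nu_stat nu_Q).
Qed.

Section Event.
Context (theta : T -> int).
Hypothesis theta_meas : forall j, measurable (theta @^-1` [set j]).

Definition exceedance := [set w | exists (x : past A) (i : int),
  theta w <= i <= 0 /\ enat_lt (Some k)
    (L I (append x (string (F I) x (path w) (theta w) (i - 1))) (U i w))].

Lemma exceedsP w x i : theta w <= i ->
  enat_lt (Some k)
    (L I (append x (string (F I) x (path w) (theta w) (i - 1))) (U i w)) =
  exceeds I k x (path w) (theta w) `|(i - theta w)%R|%N.
Proof. exact: (@exceeds_string _ _ I k x (path w)). Qed.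

(** Splitting over the countably many values of the run freezes the past at which [L] is evaluated;
    only its dependence on one innovation is left. *)
Lemma exceeds_measurable x m n : measurable [set w | exceeds I k x (path w) m n].
Proof.
have U01 w j : 0 <= U j w < 1 by exact: iid_uniform_itv hU _ _.
rewrite (_ : [set _ | _] = [set w | exists t : seq A,
    run (F I) x (path w) m n = t /\
    [set v | 0 <= v < 1 /\ enat_lt (Some k) (L I (append x t) v)] (U (m + n%:Z) w)]).
  apply: measurable_ex => t; apply: measurable_and_prop.
    apply: (@path_measurable0 _ _ _ _ U [set u | run (F I) x u m n = t]).
    exact: run_measurable simulates_F _ _ _ _.
  pose B := [set v | 0 <= v < 1 /\ enat_lt (Some k) (L I (append x t) v)].
  apply: (@path_measurable0 _ _ _ _ U [set u | B (u (m + n%:Z))]).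
  apply: useq_coord_measurable; exact: L_measurable hI _ _.
apply/seteqP; split => w.
  by move=> ex; exists (run (F I) x (path w) m n); split => //; split.
by move=> [t [rt [_ ex]]]; rewrite /= /exceeds rt.
Qed.

(* The first symbol read beyond depth [k] only depends on the last [k] symbols
   of the initial past, so countably many pasts exhaust the event. *)
Lemma exceedance_measurable : measurable exceedance.
Proof.
have U01 w j : 0 <= U j w < 1 by exact: iid_uniform_itv hU _ _.
rewrite (_ : exceedance = [set w | exists j : int, theta w = j /\
    exists s : k.-tuple A, exists n : nat, (j + n%:Z <= 0) /\
      exceeds I k (append point s) (path w) j n]).
  apply: measurable_ex => j; apply: measurable_and_prop; first exact: theta_meas.
  apply: measurable_ex => s; apply: measurable_ex => n.
  by apply: measurable_and_prop; [exact: measurable_prop|exact: exceeds_measurable].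
apply/seteqP; split => w.
  move=> [x [i [/andP[ti i0]]]]; rewrite exceedsP// => ex.
  exists (theta w); split => //; exists (recent k x).
  have [|n ni exn] := exceeds_local hI (y := append point (recent k x)) (U01 w) _ ex.
    by rewrite recent_append.
  by exists n; split => //; lia.
move=> [_ [<- [s [n [n0 ex]]]]]; exists (append point s), (theta w + n%:Z).
split; first by rewrite lerDl n0.
by rewrite exceedsP ?lerDl// (_ : `|_|%N = n)//; lia.
Qed.

Lemma origin_symbol_eq w :
  (Theta0 (F I) (path w) `&` Theta0 (Fk Pk I) (path w) !=set0) ->
  Theta0 (F I) (path w) (theta w) -> ~ exceedance w ->
  origin_symbol (F I) (path w) = origin_symbol (Fk Pk I) (path w).
Proof.
move=> [_ [_ _]] tw nex; have [t0 tF] := tw.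
have U01 j : 0 <= U j w < 1 by exact: iid_uniform_itv hU _ _.
have lastE x : last_symbol (Fk Pk I) x (path w) (theta w) 0 =
               last_symbol (F I) x (path w) (theta w) 0.
  rewrite /last_symbol /string t0 (run_Fk hI kept_le)// => i it.
  apply/negP => ex; apply: nex; exists x, (theta w + i%:Z).
  split; first by rewrite lerDl/=; lia.
  by rewrite exceedsP ?lerDl// (_ : `|_|%N = i)//; lia.
have tk : Theta0 (Fk Pk I) (path w) (theta w).
  by split => // x y; rewrite !lastE.
have [_ hF] := Theta0_origin tw; have [_ hk] := Theta0_origin tk.
by rewrite -(hF point) -(hk point) lastE.
Qed.

End Event.

End Coupling.

Theorem lemma4p1 (R : realType) (N : alphabet_size)
  (P : alphabet N -> past (alphabet N) -> R) (hP : is_kernel P)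
  (mu : probability (traj (alphabet N)) R)
  (mu_stat : stationary mu) (mu_P : compatible mu P)
  (k : nat)
  (Pk : alphabet N -> k.-tuple (alphabet N) -> R)
  (hPk : is_markov_kernel P mu Pk)
  (muk : probability (traj (alphabet N)) R)
  (hmuk : is_markov_approximation mu Pk muk)
  (I : past (alphabet N) -> enat -> alphabet N -> set R)
  (hI : is_range_partition P I)
  (d : measure_display) (T : measurableType d) (Pr : probability T R)
  (U : int -> {RV Pr >-> R}) (hU : iid_uniform U)
  (hTheta : {ae Pr, forall w,
     Theta0 (F I) (fun n => U n w) `&` Theta0 (Fk Pk I) (fun n => U n w)
       !=set0})
  (theta : T -> int)
  (theta_meas : forall j, measurable (theta @^-1` [set j]))
  (htheta : {ae Pr, forall w, Theta0 (F I) (fun n => U n w) (theta w)}) :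
  (dbar mu muk <=
   Pr [set w | exists (x : past (alphabet N)) (i : int),
         (theta w <= i <= 0)%R /\
         enat_lt (Some k)
           (L I (append x (string (F I) x (fun n => U n w) (theta w) (i - 1)))
                (U i w))])%E.
Proof.
pose V w := fun n => U n w.
pose Gk := Fk Pk I.
have simF := simulates_F hI.
have simFk := simulates_Fk hI hP mu_P hPk.
have [muk_stat muk_P _] := hmuk.
have hTF : {ae Pr, forall w, Theta0 (F I) (V w) !=set0}.
  by apply: filterS hTheta => w [j [j1 _]]; exists j.
have hTFk : {ae Pr, forall w, Theta0 Gk (V w) !=set0}.
  by apply: filterS hTheta => w [j [_ j2]]; exists j.
have mZ := measurable_fun_pair (limit_path_measurable U simF)
  (limit_path_measurable U simFk).
pose Z : {mfun T >-> (traj (alphabet N) * traj (alphabet N))%type} :=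
  mfun_Sub (mem_set mZ).
pose D := [set w | limit_traj (F I) (V w) 0 <> limit_traj Gk (V w) 0].
apply: (@le_trans _ _ (Pr D)).
  apply: ereal_inf_lbound; exists (distribution Pr Z) => //.
  move=> B mB; split.
    by rewrite (limit_path_law hU simF hP mu_stat mu_P hTF mB).
  by rewrite (limit_path_law hU simFk (markov_is_kernel hPk) muk_stat muk_P hTFk mB).
have mD : measurable D.
  (* As the alphabet is countable, disagreement is split over the value [a] of the first limit,
     leaving conditions on one trajectory at a time. *)
  rewrite (_ : D = [set w | exists a, limit_traj (F I) (V w) 0 = a /\
                                      ~ (limit_traj Gk (V w) 0 = a)]).
    apply: measurable_ex => a; apply: measurable_and_prop.
      have := limit_path_measurable U simF measurableT (coordinate_measurable (0 : int) a).
      by rewrite setTI.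
    apply: measurableC.
    have := limit_path_measurable U simFk measurableT (coordinate_measurable (0 : int) a).
    by rewrite setTI.
  apply/seteqP; split => w.
    by move=> Dw; exists (limit_traj (F I) (V w) 0); split => // e; exact: (Dw (esym e)).
  by move=> [a [Fa ne]] e; apply: ne; rewrite -e.
have mE : measurable (exceedance I k U theta) by apply: (exceedance_measurable hI).
(* Coalescence is known only almost surely and events about [Theta0] need not be measurable. The
   part of [D] outside the exceedance is therefore enclosed in a measurable null set [M], which is
   added to the bound at no cost. *)
have [M [mM M0 hM]] : Pr.-negligible (D `\` exceedance I k U theta).
  suff : {ae Pr, forall w, ~ (D `\` exceedance I k U theta) w}.
    by apply: negligibleS => w /= h nh; exact: nh.
  apply: filterS2 hTheta htheta => w hT ht [Dw nE]; apply: Dw.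
  have := origin_symbol_eq hI hP mu_P hPk hU hT ht nE.
  rewrite /limit_traj.
  have -> : (fun j => V w (j + 0)) = V w by apply/funext => j; rewrite addr0.
  by [].
rewrite -[leRHS]adde0 -M0; apply: (@le_trans _ _ (Pr (exceedance I k U theta `|` M))).
  apply: le_measure; rewrite ?inE//; first exact: measurableU.
  move=> w Dw; have [Ew|nE] := EM (exceedance I k U theta w); first by left.
  by right; apply: hM.
exact: measureU2.
Qed.
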